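(* Let $T,T_1,T_2\in\mathcal{B}(\mathcal{H})$ be contractions. Then: (i) if $T_1T_2=T_2T_1$, then $A_{T_1T_2}\le A_{T_1}$ and $A_{T_1T_2}\le A_{T_2}$; (ii) if $T$ is completely non-unitary and $u\in H^\infty$ is a non-constant inner function, then $A_T=A_{u(T)}$; (iii) if $A_{T_1}=A_{T_2}=A$, then $A\le A_{T_1T_2}$; (iv) if $T_1T_2=T_2T_1$ and $A_{T_1}=A_{T_2}$, then $A_{T_1T_2}=A_{T_1}=A_{T_2}$.
   Context: For a contraction $T$, $A_T$ denotes the strong-operator limit of $T^{*n}T^n$. A contraction is completely non-unitary (c.n.u.) if it has no nonzero reducing subspace on which it is unitary. $H^\infty$ is the algebra of bounded analytic functions on the open unit disc; an inner function is $u\in H^\infty$ with $|u|=1$ a.e. on the unit circle. For a c.n.u. contraction $T$, $u(T)$ is defined via the Sz.-Nagy–Foias $H^\infty$-functional calculus (the contractive, weak-* continuous algebra homomorphism $H^\infty\to\mathcal{B}(\mathcal{H})$ sending $1\mapsto I$ and $z\mapsto T$). *)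

(* Defs.v *)
From HB Require Import structures.
From mathcomp Require Import all_boot all_order all_algebra.
From mathcomp Require Import all_classical all_reals all_analysis.
From mathcomp Require Import complex.
Set Implicit Arguments. Unset Strict Implicit. Unset Printing Implicit Defensive.
Import Order.TTheory GRing.Theory Num.Theory numFieldNormedType.Exports.
Local Open Scope classical_set_scope.
Local Open Scope ring_scope.
Local Open Scope complex_scope.

Section Defs.
Variable R : realType.
Variable H : completeNormedModType R[i].

(* ip is an inner_function product on H inducing the norm of H; together with the
   completeness of H this makes H a complex Hilbert space. *)
Definition is_inner_product (ip : H -> H -> R[i]) : Prop :=
  [/\ forall (a : R[i]) (x y z : H), ip (a *: x + y) z = a * ip x z + ip y z,
      forall x y : H, ip x y = (ip y x)^* &
      forall x : H, ip x x = `|x| ^+ 2].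

Definition bounded_op (T : H -> H) : Prop :=
  (forall (a : R[i]) (x y : H), T (a *: x + y) = a *: T x + T y) /\
  exists M : R[i], forall x : H, `|T x| <= M * `|x|.

Definition op_contraction (T : H -> H) : Prop :=
  bounded_op T /\ forall x : H, `|T x| <= `|x|.

Definition is_adjoint (ip : H -> H -> R[i]) (T Ts : H -> H) : Prop :=
  forall x y : H, ip (T x) y = ip x (Ts y).

Definition is_A_T (ip : H -> H -> R[i]) (T A : H -> H) : Prop :=
  exists Ts : H -> H, is_adjoint ip T Ts /\
    forall x : H, (fun n : nat => iter n Ts (iter n T x)) @ \oo --> A x.

Definition op_le (ip : H -> H -> R[i]) (A B : H -> H) : Prop :=
  forall x : H, ip (A x) x <= ip (B x) x.

Definition closed_subspace (M : set H) : Prop :=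
  [/\ closed M, M 0 &
      forall (a : R[i]) (x y : H), M x -> M y -> M (a *: x + y)].

Definition op_cnu (ip : H -> H -> R[i]) (T : H -> H) : Prop :=
  forall Ts : H -> H, is_adjoint ip T Ts ->
  forall M : set H, closed_subspace M ->
    T @` M `<=` M -> Ts @` M `<=` M ->
    (forall x, M x -> `|T x| = `|x|) -> M `<=` T @` M ->
    M = [set 0].

Definition H_infty (u : R[i]^o -> R[i]^o) : Prop :=
  (forall z : R[i]^o, `|z| < 1 -> derivable u z 1) /\
  exists M : R[i], forall z : R[i]^o, `|z| < 1 -> `|u z| <= M.

Definition inner_function (u : R[i]^o -> R[i]^o) : Prop :=
  H_infty u /\
  {ae (@lebesgue_measure R), forall t : R, exists w : R[i]^o,
      `|w| = 1 /\
      (fun r : R => u ((r%:C * (cos t +i* sin t)) : R[i]^o)) @ 1^'- --> w}.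

Definition nonconstant_on_disc (u : R[i]^o -> R[i]^o) : Prop :=
  ~ exists c : R[i]^o, forall z : R[i]^o, `|z| < 1 -> u z = c.

(* Sz.-Nagy--Foias H^infinity functional calculus for a c.n.u. op_contraction T:
   if u(z) = sum_n a_n z^n on the disc, then
   u(T) x = lim_{r -> 1-} sum_n a_n r^n T^n x. *)
Definition is_funcalc (T : H -> H) (u : R[i]^o -> R[i]^o) (uT : H -> H) : Prop :=
  exists a : nat -> R[i]^o,
    (forall z : R[i]^o, `|z| < 1 ->
       series (fun n : nat => a n * z ^+ n) @ \oo --> u z) /\
    forall x : H,
      (fun r : R => limn (series (fun n : nat =>
          ((a n : R[i]) * (r%:C) ^+ n) *: iter n T x))) @ 1^'- --> uT x.

End Defs.

(* Main.v *)
(** Write [q_T x = lim |T^n x|^2 = <A_T x, x>]; since [A_T] is determined by the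
    quadratic form [q_T], everything is a statement about these limits.  Parts
    (i), (iii), (iv) follow from [q_T (T x) = q_T x <= |x|^2].

    For (ii) put [W = u(T)] and approximate [u] by polynomials [p] (truncations of
    [u (r z)]) such that [|p|^2 - 1] tends to 0 in [L^2] of the circle (dominated
    convergence) and [p(T) x -> W x].

    [q_T <= q_W] (a prime denotes the adjoint): it suffices that
    [B = A_T - W' A_T W] vanishes.  The sequence [h_n = T'^n A_T w], continued by
    [h_-n = A_T T^n w], satisfies [h_(n+1) = T' h_n] for all [n], so its energy in
    the form [<(I - T T') x, y>] telescopes and is finite; integrating this form against [|p|^2 - 1] over the circle shows
    that [B] kills [T^q (I - T T') y].  As [T' B T = B], the range of [B] then lies
    in the unitary part of [T], which is trivial.

    [q_W <= q_T]: the Fourier coefficients of [p(e^it) sum_k e^-ikt T^k y] are the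
    vectors [T^n p(T) y] and [p_i(T) y], [p_i] being the [i]-th backward shift of
    [p].  Comparing energies in the form [|x|^2 - |T x|^2] gives a von Neumann
    inequality with remainder,
    [|p(T) y|^2 + (|p_i(T) y|^2 - |T p_i(T) y|^2) <= |y|^2 + error].
    Since [p_i(T) y - p_(i+1)(T) T y] is the [i]-th coefficient times [y], the
    defect [|y|^2 - |T y|^2] is controlled by [|y|^2 - |W y|^2] and
    [|T y|^2 - |W T y|^2]; on [y = W^n x] these tend to 0, so [q_W] is
    [T]-invariant and hence at most [q_T]. *)

Require Import Defs.
From HB Require Import structures.
From mathcomp Require Import all_boot all_order all_algebra.
From mathcomp Require Import all_classical all_reals all_analysis.
From mathcomp Require Import complex ring lra.
Set Implicit Arguments. Unset Strict Implicit. Unset Printing Implicit Defensive.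
Import Order.TTheory GRing.Theory Num.Theory numFieldNormedType.Exports.
Local Open Scope classical_set_scope.
Local Open Scope ring_scope.
Local Open Scope complex_scope.
(* [Num.Theory] exports homonymous maps [C -> C]. *)
Local Notation Re := complex.Re.
Local Notation Im := complex.Im.

(** * Real parts and squared moduli of complex numbers *)

Section ComplexParts.
Context {R : realType}.
Implicit Types (z w : R[i]) (r : R).

Lemma ReD z w : Re (z + w) = Re z + Re w.
Proof. by case: z w => ? ? [? ?]. Qed.

Lemma ReM z w : Re (z * w) = Re z * Re w - Im z * Im w.
Proof. by case: z w => ? ? [? ?]. Qed.

Lemma ImM z w : Im (z * w) = Re z * Im w + Im z * Re w.
Proof. by case: z w => ? ? [? ?]. Qed.

Lemma ReZ r z : Re (r%:C * z) = r * Re z.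
Proof. by rewrite ReM /= mul0r subr0. Qed.

Lemma Re_conj z : Re z^*%C = Re z.
Proof. by case: z. Qed.

Lemma Re_sum (I : Type) (s : seq I) (P : pred I) (F : I -> R[i]) :
  Re (\sum_(i <- s | P i) F i) = \sum_(i <- s | P i) Re (F i).
Proof. exact: (big_morph _ ReD erefl). Qed.

Lemma Re_normrK (V : normedZmodType R[i]) (x : V) : (Re `|x|)%:C = `|x|.
Proof. by rewrite RRe_real// ger0_real. Qed.

Lemma normc_lt (V : normedZmodType R[i]) (x : V) r : (`|x| < r%:C) = (Re `|x| < r).
Proof. by rewrite -Re_normrK ltcR. Qed.

Definition csq z : R := Re z ^+ 2 + Im z ^+ 2.

Lemma csqE z : csq z = Re `|z| ^+ 2.
Proof. by apply: complexI; rewrite add_Re2_Im2 -Re_normrK -rmorphXn. Qed.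

Lemma csqM z w : csq (z * w) = csq z * csq w.
Proof. by rewrite /csq ReM ImM; ring. Qed.

Lemma mulcJ z : z * z^*%C = (csq z)%:C.
Proof. by case: z => a b; congr Complex; rewrite /csq /=; ring. Qed.

Lemma csq_ge0 z : 0 <= csq z.
Proof. by rewrite addr_ge0 ?sqr_ge0. Qed.

Lemma Re_norm_ge0 (V : normedZmodType R[i]) (x : V) : 0 <= Re `|x|.
Proof. by rewrite -lecR Re_normrK normr_ge0. Qed.

Lemma Re_norm_csq z : Re `|z| = Num.sqrt (csq z).
Proof. by rewrite normc_def. Qed.

End ComplexParts.

(** * Norms and convergence in terms of real numbers *)

Section RealNorm.
Context {R : realType} {V : normedModType R[i]}.
Implicit Types (x y : V) (a : R[i]).

(* Norms over [R[i]] take values in [R[i]]. *)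
Definition nr x : R := Re `|x|.

Lemma nr_ge0 x : 0 <= nr x. Proof. exact: Re_norm_ge0. Qed.

Lemma nr0 : nr 0 = 0. Proof. by rewrite /nr normr0. Qed.

Lemma nr_eq0 x : nr x = 0 -> x = 0.
Proof. by move=> h; apply/normr0_eq0; rewrite -Re_normrK -[Re _]/(nr x) h. Qed.

Lemma ler_nrD x y : nr (x + y) <= nr x + nr y.
Proof. by rewrite -lecR rmorphD/= !Re_normrK ler_normD. Qed.

Lemma nrZ a x : nr (a *: x) = Re `|a| * nr x.
Proof. by rewrite /nr normrZ -(Re_normrK a) ReZ. Qed.

Lemma nrN x : nr (- x) = nr x. Proof. by rewrite /nr normrN. Qed.

Lemma nrB x y : nr (x - y) = nr (y - x). Proof. by rewrite /nr distrC. Qed.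

Lemma ler_nr_sum (I : Type) (s : seq I) (P : pred I) (F : I -> V) :
  nr (\sum_(i <- s | P i) F i) <= \sum_(i <- s | P i) nr (F i).
Proof.
elim/big_rec2: _ => [|i r x _ h]; first by rewrite nr0.
by apply: le_trans (ler_nrD _ _) _; rewrite lerD2l.
Qed.

Lemma cvg_nrP {I : Type} (F : set_system I) {FF : Filter F} (f : I -> V) x :
  f @ F --> x <-> (forall e : R, 0 < e -> \forall i \near F, nr (x - f i) < e).
Proof.
split=> [/cvgrPdist_lt h e e0|h].
  have /h : 0 < e%:C :> R[i] by rewrite ltcR.
  by apply: filterS => i; rewrite normc_lt.
apply/cvgrPdist_lt => e e0.
have ee : e = (Re e)%:C by rewrite RRe_real// gtr0_real.
have /h : 0 < Re e by rewrite -ltcR -ee.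
by apply: filterS => i; rewrite {2}ee normc_lt.
Qed.

Lemma ler_nr_dist x y : `|nr x - nr y| <= nr (x - y).
Proof.
rewrite ler_norml lerNl opprB !lerBlDr {1}nrB.
by apply/andP; split; apply: le_trans (ler_nrD _ _); rewrite subrK.
Qed.

Lemma cvg_nr {I : Type} (F : set_system I) {FF : Filter F} (f : I -> V) x :
  f @ F --> x -> (fun i => nr (f i)) @ F --> nr x.
Proof.
move=> /cvg_nrP fx; apply/cvgrPdist_lt => e e0.
by apply: filterS (fx _ e0) => i; apply: le_lt_trans; exact: ler_nr_dist.
Qed.

Lemma tail_le (v : V ^nat) x N (e : R) : series v @ \oo --> x ->
  (forall N', \sum_(N <= j < N') nr (v j) <= e) -> nr (x - series v N) <= e.
Proof.
move=> /cvg_nrP vx tl; apply/ler_addgt0Pl => d d0.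
have [M _ hM] := vx _ d0.
have := hM (maxn M N) (leq_maxl _ _).
rewrite -[x - series v N](subrKA (series v (maxn M N))) => /ltW h.
apply: le_trans (ler_nrD _ _) _; apply: lerD => //.
rewrite sub_series_geq ?leq_maxr//.
exact: le_trans (ler_nr_sum _ _ _) (tl _).
Qed.

End RealNorm.

Lemma nrM {R : realType} (z w : R[i]^o) : nr (z * w) = nr z * nr w.
Proof. exact: nrZ. Qed.

Lemma nr_real {R : realType} (r : R) : 0 <= r -> nr (r%:C : R[i]^o) = r.
Proof. by move=> r0; rewrite /nr normc_def /= expr0n addr0 sqrtr_sqr ger0_norm. Qed.

Lemma csq_nr {R : realType} (z : R[i]^o) : csq z = nr z ^+ 2.
Proof. exact: csqE. Qed.

Lemma series_cvg_nr {R : realType} {V : completeNormedModType R[i]}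
    (v : V ^nat) (b : R ^nat) :
  (forall n, nr (v n) <= b n) -> cvgn (series b) -> cvgn (series v).
Proof.
move=> vb /cvg_cauchy/cauchy_seriesP cb.
apply/cauchy_cvgP/cauchy_seriesP => e e0.
have ee : e = (Re e)%:C by rewrite RRe_real// gtr0_real.
have /cb : 0 < Re e by rewrite -ltcR -ee.
apply: filterS => -[m n] /=; rewrite {2}ee normc_lt; apply: le_lt_trans.
apply: le_trans (ler_nr_sum _ _ _) _; apply: le_trans (ler_norm _).
by apply: ler_sum => i _; exact: vb.
Qed.

(** * Means over the circle *)

Section CircleMean.
Context {R : realType}.
Implicit Types (f g : R -> R) (s t k : R) (a : R[i]).

Definition cis t : R[i] := cos t +i* sin t.

Lemma cisD s t : cis (s + t) = cis s * cis t.
Proof.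
by apply/eqP; rewrite eq_complex /= cosD sinD eqxx/= [X in _ == X]addrC.
Qed.

Lemma cisX t n : cis t ^+ n = cis (n%:R * t).
Proof.
elim: n => [|n IH]; first by rewrite mul0r /cis cos0 sin0.
by rewrite exprS IH -cisD -{1}[t]mul1r -mulrDl nat1r.
Qed.

Lemma conj_cis t : (cis t)^*%C = cis (- t).
Proof. by rewrite /cis cosN sinN. Qed.

Lemma csq_cis t : csq (cis t) = 1.
Proof. by rewrite /csq /= cos2Dsin2. Qed.

Lemma cis_2pi : cis (2 * pi) = 1.
Proof. by rewrite mulr_natl /cis cos2pi sin2pi. Qed.

Local Notation mu := (@lebesgue_measure R).
Local Notation circ := (`[(0 : R), 2 * pi]%classic).

Lemma integrable_circ f : continuous f -> mu.-integrable circ (EFin \o f).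
Proof.
move=> cf; apply: continuous_compact_integrable; first exact: segment_compact.
exact: continuous_subspaceT.
Qed.

(** The integral over the circle is not normalised; this is the source of the later factors
    [2 * pi]. *)
Definition cint f : R := \int[mu]_(t in circ) f t.

Lemma cintD f g : continuous f -> continuous g ->
  cint (fun t => f t + g t) = cint f + cint g.
Proof. by move=> cf cg; rewrite /cint RintegralD//; exact: integrable_circ. Qed.

Lemma cintZ k f : continuous f -> cint (fun t => k * f t) = k * cint f.
Proof. by move=> cf; rewrite /cint RintegralZl//; exact: integrable_circ. Qed.

Lemma cint_cst k : cint (fun=> k) = k * (2 * pi).
Proof.
by rewrite /cint Rintegral_cst//= lebesgue_measure_itv/= lte_fin
  mulr_gt0 ?pi_gt0// sube0.
Qed.

Lemma le_cint f g : continuous f -> continuous g -> (forall t, f t <= g t) ->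
  cint f <= cint g.
Proof.
by move=> cf cg fg; apply: le_Rintegral => //; exact: integrable_circ.
Qed.

Lemma continuous_sum (I : Type) (r : seq I) (F : I -> R -> R) :
  (forall i, continuous (F i)) -> continuous (fun t => \sum_(i <- r) F i t).
Proof.
move=> cF; elim: r => [|i r IH] t.
  by under eq_fun do rewrite big_nil; exact: cvg_cst.
under eq_fun do rewrite big_cons.
by apply: cvgD; [exact: cF|exact: IH].
Qed.

Lemma cint_sum (I : Type) (r : seq I) (F : I -> R -> R) :
  (forall i, continuous (F i)) ->
  cint (fun t => \sum_(i <- r) F i t) = \sum_(i <- r) cint (F i).
Proof.
move=> cF; elim: r => [|i r IH].
  by under eq_fun do rewrite big_nil; rewrite big_nil cint_cst mul0r.
under eq_fun do rewrite big_cons.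
by rewrite cintD ?IH ?big_cons//; exact: continuous_sum.
Qed.

Lemma continuous_Re_cis a k : continuous (fun t => Re (a * cis (k * t))).
Proof.
move=> t; under eq_fun do rewrite ReM /=.
have ck : {for t, continuous (fun s => k * s)}.
  by apply: cvgM; [exact: cvg_cst|exact: cvg_id].
apply: cvgB; apply: cvgM; try exact: cvg_cst.
- by apply: continuous_comp ck _; exact: continuous_cos.
- by apply: continuous_comp ck _; exact: continuous_sin.
Qed.

(** The antiderivative [Im (a * cis (k * t)) / k] takes the same value at both ends of the
    interval. *)
Lemma cint_Re_cis0 a k : k != 0 -> cis (k * (2 * pi)) = 1 ->
  cint (fun t => Re (a * cis (k * t))) = 0.
Proof.
move=> k0 k1.
pose F t := Im (a * cis (k * t)) / k.
have dF (t : R) : is_derive t 1 F (Re (a * cis (k * t))).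
  rewrite /F; under eq_fun do rewrite ImM /=.
  by rewrite ReM /=; apply: is_derive_eq; rewrite /GRing.scale /=; field.
have twopi : 0 < 2 * pi :> R by rewrite mulr_gt0 ?pi_gt0.
rewrite /cint /Rintegral (@continuous_FTC2 _ _ F)//=.
- by rewrite /F k1 mulr0 /cis cos0 sin0 subrr.
- exact/continuous_subspaceT/continuous_Re_cis.
- have cF : continuous F.
    by move=> t; apply/differentiable_continuous/derivable1_diffP/ex_derive.
  split; first by move=> t _; exact: ex_derive.
  + exact/cvg_at_right_filter/cF.
  + exact/cvg_at_left_filter/cF.
- by move=> t _; rewrite derive1E derive_val.
Qed.

Lemma trig_cis (t : R) n m :
  cis t ^+ n * (cis t)^*%C ^+ m = cis ((n%:R - m%:R) * t).
Proof. by rewrite conj_cis !cisX -cisD mulrN mulrBl. Qed.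

Lemma continuous_Re_trig (I : Type) (r : seq I) (a : I -> R[i]) (n m : I -> nat) :
  continuous (fun t => Re (\sum_(i <- r) a i * (cis t ^+ n i * (cis t)^*%C ^+ m i))).
Proof.
under eq_fun do rewrite Re_sum; apply: continuous_sum => i.
by under eq_fun do rewrite trig_cis; exact: continuous_Re_cis.
Qed.

(** Orthogonality of characters. A frequency is encoded by two natural exponents, one for [cis t]
    and one for its conjugate, so that frequency zero reads [n i == m i]. *)
Lemma cint_Re_trig (I : Type) (r : seq I) (a : I -> R[i]) (n m : I -> nat) :
  cint (fun t => Re (\sum_(i <- r) a i * (cis t ^+ n i * (cis t)^*%C ^+ m i))) =
  2 * pi * Re (\sum_(i <- r | n i == m i) a i).
Proof.
under eq_fun do rewrite Re_sum; rewrite cint_sum; last first.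
  by move=> i; under eq_fun do rewrite trig_cis; exact: continuous_Re_cis.
rewrite Re_sum [in RHS]big_mkcond/= mulr_sumr; apply: eq_bigr => i _.
under eq_fun do rewrite trig_cis.
case: ifPn => [/eqP ->|nm].
  rewrite subrr; under eq_fun do rewrite mul0r /cis cos0 sin0.
  by rewrite cint_cst mulr1 mulrC.
rewrite mulr0 cint_Re_cis0//; first by rewrite subr_eq0 eqr_nat.
by rewrite -trig_cis cis_2pi conjc1 !expr1n mulr1.
Qed.

Definition cpoly (c : nat -> R[i]) N (z : R[i]) : R[i] := \sum_(j < N) c j * z ^+ j.

Lemma continuous_csq_cpoly c N : continuous (fun t => csq (cpoly c N (cis t))).
Proof.
have cRe (b : nat -> R[i]) : continuous (fun t => Re (cpoly b N (cis t))).
  have := @continuous_Re_trig _ (index_enum 'I_N) (fun i => b i) (fun i => i) (fun=> 0%N).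
  by under eq_fun do under eq_bigr do rewrite expr0 mulr1.
have ImE (t : R) : Im (cpoly c N (cis t)) = - Re (cpoly (fun j => 'i * c j) N (cis t)).
  rewrite (_ : cpoly (fun j => 'i * c j) N (cis t) = 'i * cpoly c N (cis t)).
    by rewrite ReM /= mul0r mul1r add0r opprK.
  by rewrite /cpoly mulr_sumr; under eq_bigr do rewrite -mulrA.
move=> t; under eq_fun do rewrite /csq ImE sqrrN expr2.
by apply: cvgD; apply: cvgM; exact: cRe.
Qed.

(** The squared $L^2$ distance from $|p|^2$ to 1 on the circle; it measures how far the polynomial
    $p$ is from being inner. *)
Definition defect c N : R := cint (fun t => (csq (cpoly c N (cis t)) - 1) ^+ 2).

Lemma continuous_defect c N :
  continuous (fun t => (csq (cpoly c N (cis t)) - 1) ^+ 2).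
Proof.
have h : continuous (fun t => csq (cpoly c N (cis t)) - 1).
  by move=> t; apply: cvgB; [exact: continuous_csq_cpoly|exact: cvg_cst].
by move=> t; under eq_fun do rewrite expr2; apply: cvgM; exact: h.
Qed.

End CircleMean.

(** * Polynomial approximation of inner functions *)

Section InnerApprox.
Context {R : realType} (u : R[i]^o -> R[i]^o) (a : nat -> R[i]^o).
Hypothesis au : forall z : R[i]^o, `|z| < 1 ->
  series (fun n => a n * z ^+ n) @ \oo --> u z.
Implicit Types r : R.

(** Abel's argument: for [s] strictly between [r] and 1 the terms at [s] are bounded by some [K], so
    the terms at [r] are dominated by the geometric sequence $K (r/s)^n$. *)
Lemma nr_series_cvg r : 0 <= r < 1 -> cvgn (series (fun n => nr (a n) * r ^+ n)).
Proof.
move=> /andP[r0 r1].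
have [s rs s1] : exists2 s : R, r < s & s < 1 by exists ((r + 1) / 2); lra.
have s0 : 0 < s by lra.
have sz : `|s%:C : R[i]^o| < 1 by rewrite normc_lt -[Re _]/(nr _) nr_real ?ltW.
have /cvg_series_cvg_0/cvg_nrP/(_ 1 ltr01)[N _ hN] :
    cvgn (series (fun n => a n * (s%:C : R[i]^o) ^+ n)).
  by apply/cvg_ex; exists (u s%:C); exact: au.
pose K := 1 + \sum_(j < N) nr (a j) * s ^+ j.
have aK n : nr (a n) * s ^+ n <= K.
  have Snn : 0 <= \sum_(j < N) nr (a j) * s ^+ j.
    by apply: sumr_ge0 => j _; rewrite mulr_ge0 ?nr_ge0 ?exprn_ge0 ?ltW.
  have [nN|Nn] := ltnP n N.
    rewrite /K (bigD1 (Ordinal nN))//= addrCA lerDl addr_ge0//.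
    by apply: sumr_ge0 => j _; rewrite mulr_ge0 ?nr_ge0 ?exprn_ge0 ?ltW.
  have /ltW := hN _ Nn; rewrite sub0r nrN.
  rewrite (_ : nr _ = nr (a n) * s ^+ n); first by move=> h; rewrite ler_wpDr.
  by rewrite nrM -rmorphXn nr_real ?exprn_ge0 ?ltW.
apply: (@series_le_cvg _ _ (geometric K (r / s))).
- by move=> n; rewrite mulr_ge0 ?nr_ge0 ?exprn_ge0.
- move=> n /=; rewrite mulr_ge0 ?exprn_ge0 ?divr_ge0 ?(ltW s0)//.
  by apply: le_trans (aK 0%N); rewrite mulr_ge0 ?nr_ge0.
- move=> n /=; rewrite expr_div_n [leRHS]mulrCA [leRHS]mulrC ler_wpM2r ?exprn_ge0//.
  by rewrite ler_pdivlMr ?exprn_gt0.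
- apply: is_cvg_geometric_series.
  by rewrite ger0_norm ?divr_ge0 ?ltr_pdivrMr ?mul1r ?(ltW s0).
Qed.

Lemma nr_tail r (e : R) : 0 <= r < 1 -> 0 < e -> exists N0, forall N N', (N0 <= N)%N ->
  \sum_(N <= j < N') nr (a j) * r ^+ j <= e.
Proof.
move=> r01 e0; have /cvg_cauchy/cauchy_seriesP/(_ _ e0) := nr_series_cvg r01.
move=> [[A B] /= [[N1 _ h1] [N2 _ h2]] h].
exists (maxn N1 N2) => N N'; rewrite geq_max => /andP[n1 n2].
have [NN'|N'N] := leqP N N'.
  apply: le_trans (ler_norm _) _; apply/ltW.
  by apply: (h (N, N')); split => /=; [exact: h1|exact: h2 (leq_trans n2 NN')].
by rewrite big_geq ?(ltnW N'N) ?ltW.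
Qed.

Definition radius k : R := 1 - k.+1%:R^-1.

Lemma radius_itv k : 0 <= radius k < 1.
Proof. by rewrite /radius subr_ge0 invf_le1// ler1n/= gtrBl invr_gt0. Qed.

Lemma cvg_radius : radius @ \oo --> (1 : R).
Proof.
by rewrite -[X in _ --> X]subr0; apply: cvgB; [exact: cvg_cst|exact: cvg_harmonic].
Qed.

(** Radial limits are taken along [1^'-], dominated convergence along a sequence; the strict bound
    [radius k < 1] makes the transfer possible. *)
Lemma cvg_radius_left : radius @ \oo --> 1^'-.
Proof.
move=> P hP.
have h : \forall k \near \oo, radius k < 1 -> P (radius k) := cvg_radius hP.
by apply: (@filterS _ \oo _ _ _ _ h) => k; apply; case/andP: (radius_itv k).
Qed.

(** The Taylor coefficients of $z \mapsto u(r_k z)$ with $r_k$ = [radius k]. *)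
Definition rcoef k j : R[i] := a j * (radius k)%:C ^+ j.

(** The degree [N k] is taken so large that the truncation is uniformly within $1/(k+1)$ of $u(r_k
    z)$ on the circle; dominated convergence then gives the limit of the defects. The bound
    [k <= N k] ensures that any fixed coefficient is eventually kept. *)
Lemma inner_approx : inner_function u -> exists N : nat -> nat,
  [/\ forall k, (k <= N k)%N,
      forall k N', \sum_(N k <= j < N') nr (a j) * radius k ^+ j <= k.+1%:R^-1 &
      (fun k => defect (rcoef k) (N k)) @ \oo --> 0].
Proof.
move=> [[_ [M uM]] uae].
have /choice[N hN] : forall k, exists n, (k <= n)%N /\ (forall N',
    \sum_(n <= j < N') nr (a j) * radius k ^+ j <= k.+1%:R^-1).
  move=> k; have k0 : 0 < k.+1%:R^-1 :> R by rewrite invr_gt0.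
  have [n hn] := nr_tail (radius_itv k) k0.
  by exists (maxn k n); rewrite leq_maxl; split => // N'; apply: hn; exact: leq_maxr.
exists N; split => [k|k N'|]; [by have [] := hN k|by have [_] := hN k|].
pose z k (t : R) : R[i]^o := (radius k)%:C * cis t.
have nrcis (t : R) j : nr (cis t ^+ j : R[i]^o) = 1.
  elim: j => [|j IH]; first by rewrite expr0 (@nr_real R 1).
  by rewrite exprS nrM IH mulr1 /nr Re_norm_csq csq_cis sqrtr1.
have z1 k t : `|z k t| < 1.
  have /andP[r0 r1] := radius_itv k.
  rewrite (normc_lt (z k t)) -[Re _]/(nr (z k t)) nrM nr_real//.
  by have := nrcis t 1%N; rewrite expr1 => ->; rewrite mulr1.
have close k t : nr (u (z k t) - cpoly (rcoef k) (N k) (cis t)) <= k.+1%:R^-1.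
  have -> : cpoly (rcoef k) (N k) (cis t) = series (fun n => a n * z k t ^+ n) (N k).
    by rewrite /cpoly /series/= big_mkord; apply: eq_bigr => j _; rewrite exprMn mulrA.
  apply: tail_le; first exact: au.
  move=> N'; have [_ /(_ N')] := hN k; apply: le_trans; apply: ler_sum => j _.
  have /andP[r0 r1] := radius_itv k.
  by rewrite exprMn nrM nrM nrcis mulr1 -rmorphXn nr_real// exprn_ge0.
(* On the disc $|u|$ is at most [M], and the truncation error never exceeds 1. *)
pose B := Re M + 1.
have B0 : 0 <= B.
  rewrite /B addr_ge0//; have := uM _ (z1 0%N 0); rewrite lecE => /andP[_].
  by apply: le_trans; exact: Re_norm_ge0.
have pB k t : nr (cpoly (rcoef k) (N k) (cis t) : R[i]^o) <= B.
  have := ler_nrD (cpoly (rcoef k) (N k) (cis t) - u (z k t) : R[i]^o) (u (z k t)).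
  rewrite subrK => /le_trans; apply; rewrite /B addrC lerD//.
    by have := uM _ (z1 k t); rewrite lecE => /andP[].
  by rewrite nrB; apply: le_trans (close k t) _; rewrite invf_le1// ler1n.
have mf k := measurable_int _ (integrable_circ (@continuous_defect R (rcoef k) (N k))).
have [] := @dominated_convergence _ _ R (@lebesgue_measure R)
  _ _ _ (cst 0%E) (EFin \o cst ((B ^+ 2 + 1) ^+ 2)) mf _ _ _ _ => //.
(* Where the radial limit [w] exists, the polynomials converge to it as well, and $|w| = 1$ makes
   the integrand tend to 0. *)
- apply: (@filterS _ _ (ae_filter_ringOfSetsType _) _ _ _ uae) => t [w [w1 uw]] _.
  have pw : (fun k => cpoly (rcoef k) (N k) (cis t) : R[i]^o) @ \oo --> w.
    apply/cvg_nrP => e e0.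
    have e20 : 0 < e / 2 by rewrite divr_gt0.
    have /cvg_nrP/(_ _ e20) h1 : (fun k => u (z k t)) @ \oo --> w.
      exact: cvg_comp cvg_radius_left uw.
    have /cvgrPdist_lt/(_ _ e20) h2 : harmonic @ \oo --> (0 : R) := cvg_harmonic.
    apply: filterS2 h1 h2 => k h1 h2.
    rewrite -[w - _](subrKA (u (z k t))).
    apply: le_lt_trans (ler_nrD _ _) _; rewrite (splitr e) ltr_leD//.
    apply: le_trans (close k t) _.
    by move: h2; rewrite sub0r normrN ger0_norm//= => /ltW.
  apply: cvg_EFin; first exact: nearW.
  have -> : 0 = (nr w ^+ 2 - 1) ^+ 2 by rewrite /nr w1 /= expr1n subrr expr0n.
  have h : (fun k => csq (cpoly (rcoef k) (N k) (cis t)) - 1) @ \oo --> nr w ^+ 2 - 1.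
    apply: cvgB; last exact: cvg_cst.
    under eq_fun do rewrite csq_nr expr2.
    by apply: cvgM; exact: cvg_nr.
  rewrite [X in _ --> X]expr2.
  rewrite (_ : fine \o _ = fun k => (csq (cpoly (rcoef k) (N k) (cis t)) - 1) *
    (csq (cpoly (rcoef k) (N k) (cis t)) - 1)); first exact: cvgM.
  by apply/funext => k /=; rewrite expr2.
- by apply: integrable_circ => t; exact: cvg_cst.
- apply: aeW => t k _ /=; rewrite lee_fin ger0_norm ?sqr_ge0//.
  have p0 := csq_ge0 (cpoly (rcoef k) (N k) (cis t)).
  have pB2 : csq (cpoly (rcoef k) (N k) (cis t)) <= B ^+ 2.
    by rewrite csq_nr lerXn2r ?nnegrE ?nr_ge0.
  rewrite -[leLHS]real_normK ?num_real// lerXn2r ?nnegrE ?normr_ge0 ?addr_ge0 ?sqr_ge0//.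
  by rewrite ler_norml; apply/andP; split; lra.
- move=> _ _; rewrite integral0 => /fine_cvg; exact.
Qed.

End InnerApprox.

(** * Asymptotic limits of contractions *)

Section InnerProduct.
Context {R : realType} {H : completeNormedModType R[i]} (ip : H -> H -> R[i]).
Hypothesis hip : is_inner_product ip.
Implicit Types (x y z : H) (a : R[i]) (r : R).

(** The real part is a real inner product with the same norm. It still separates vectors
    ([rip_inj]), and [Im_ip] recovers the imaginary part, so estimates can be carried out in [R]. *)
Definition rip x y : R := Re (ip x y).

Lemma ipDl x y z : ip (x + y) z = ip x z + ip y z.
Proof. by case: hip => l _ _; rewrite -[x in LHS]scale1r l mul1r. Qed.

Lemma ip0l z : ip 0 z = 0.
Proof. by apply: (addrI (ip 0 z)); rewrite -ipDl !addr0. Qed.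

Lemma ipZl a x z : ip (a *: x) z = a * ip x z.
Proof. by case: hip => l _ _; rewrite -[a *: x]addr0 l ip0l addr0. Qed.

Lemma ipC x y : ip x y = (ip y x)^*%C. Proof. by case: hip. Qed.

Lemma ipDr x y z : ip x (y + z) = ip x y + ip x z.
Proof. by rewrite ipC ipDl rmorphD /= -!ipC. Qed.

Lemma ipZr a x z : ip x (a *: z) = a^*%C * ip x z.
Proof. by rewrite ipC ipZl rmorphM /= -ipC. Qed.

Lemma ip0r z : ip z 0 = 0. Proof. by rewrite ipC ip0l conjc0. Qed.

Lemma ip_suml (I : Type) (s : seq I) (P : pred I) (F : I -> H) z :
  ip (\sum_(i <- s | P i) F i) z = \sum_(i <- s | P i) ip (F i) z.
Proof. exact: (big_morph (ip^~ z) (fun x y => ipDl x y z) (ip0l z)). Qed.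

Lemma ip_sumr (I : Type) (s : seq I) (P : pred I) (F : I -> H) z :
  ip z (\sum_(i <- s | P i) F i) = \sum_(i <- s | P i) ip z (F i).
Proof. exact: (big_morph (ip z) (ipDr z) (ip0r z)). Qed.

Lemma ripxx x : rip x x = nr x ^+ 2.
Proof. by case: hip => _ _ e; rewrite /rip e -Re_normrK -rmorphXn. Qed.

Lemma ripC x y : rip x y = rip y x. Proof. by rewrite /rip ipC Re_conj. Qed.

Lemma ripDl x y z : rip (x + y) z = rip x z + rip y z.
Proof. by rewrite /rip ipDl ReD. Qed.

Lemma ripDr x y z : rip x (y + z) = rip x y + rip x z.
Proof. by rewrite /rip ipDr ReD. Qed.

Lemma ripZl r x z : rip (r%:C *: x) z = r * rip x z.
Proof. by rewrite /rip ipZl ReZ. Qed.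

Lemma ripZr r x z : rip x (r%:C *: z) = r * rip x z.
Proof. by rewrite ripC ripZl ripC. Qed.

Lemma ripNl x z : rip (- x) z = - rip x z.
Proof. by rewrite -scaleN1r -[-1](rmorphN1 (real_complex R)) ripZl mulN1r. Qed.

Lemma ripNr x z : rip x (- z) = - rip x z.
Proof. by rewrite ripC ripNl ripC. Qed.

Lemma ripBl x y z : rip (x - y) z = rip x z - rip y z.
Proof. by rewrite ripDl ripNl. Qed.

Lemma ripBr x y z : rip x (y - z) = rip x y - rip x z.
Proof. by rewrite ripDr ripNr. Qed.

Lemma rip_sq_eq0 x : rip x x = 0 -> x = 0.
Proof. by rewrite ripxx => /eqP; rewrite expf_eq0/= => /eqP/nr_eq0. Qed.

Lemma rip_inj x y : (forall z, rip x z = rip y z) -> x = y.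
Proof.
by move=> h; apply/subr0_eq/rip_sq_eq0; rewrite ripBl h subrr.
Qed.

Lemma Im_ip x y : Im (ip x y) = rip x ('i *: y).
Proof. by rewrite /rip ipZr ReM /= !mulN1r opprK mul0r add0r. Qed.

Lemma ip_inj x y : (forall z, ip x z = ip y z) -> x = y.
Proof. by move=> h; apply: rip_inj => z; rewrite /rip h. Qed.

(** Cauchy-Schwarz, by expanding the square of the norm of $|y| x - |x| y$. *)
Lemma rip_le x y : rip x y <= nr x * nr y.
Proof.
have [/nr_eq0 ->|y0] := eqVneq (nr y) 0; first by rewrite /rip ip0r nr0 mulr0.
have [/nr_eq0 ->|x0] := eqVneq (nr x) 0; first by rewrite /rip ip0l nr0 mul0r.
have xy0 : 0 < nr x * nr y by rewrite mulr_gt0 // lt0r ?nr_ge0 ?x0 ?y0.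
have := sqr_ge0 (nr ((nr y)%:C *: x - (nr x)%:C *: y)).
rewrite -ripxx ripBl !ripBr !ripZl !ripZr (ripC y x) !ripxx.
rewrite (_ : _ - _ = (nr x * nr y) * (2 * (nr x * nr y - rip x y))); last by ring.
by rewrite pmulr_rge0// => ?; lra.
Qed.

Lemma rip_norm_le x y : `|rip x y| <= nr x * nr y.
Proof. by rewrite ler_norml rip_le andbT lerNl -ripNl -(nrN x) rip_le. Qed.

Lemma cvg_ripl {I : Type} (F : set_system I) {FF : Filter F} (f : I -> H) x y :
  f @ F --> x -> (fun i => rip (f i) y) @ F --> rip x y.
Proof.
move=> /cvg_nrP fx; apply/cvgrPdist_lt => e e0.
have d0 : 0 < e / (nr y + 1) by rewrite divr_gt0// ltr_wpDl ?nr_ge0.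
apply: filterS (fx _ d0) => i h; rewrite -ripBl.
apply: le_lt_trans (rip_norm_le _ _) _.
rewrite ltr_pdivlMr in h; last by rewrite ltr_wpDl ?nr_ge0.
apply: le_lt_trans h; apply: ler_wpM2l; first exact: nr_ge0.
by rewrite lerDl.
Qed.

(** * Linear maps, contractions and adjoints *)

Definition clinear (T : H -> H) : Prop :=
  forall a x y, T (a *: x + y) = a *: T x + T y.

Lemma opD T x y : clinear T -> T (x + y) = T x + T y.
Proof. by move=> l; rewrite -[x in LHS]scale1r l scale1r. Qed.

Lemma op0 T : clinear T -> T 0 = 0.
Proof. by move=> l; apply: (addrI (T 0)); rewrite -opD// !addr0. Qed.

Lemma opZ T a x : clinear T -> T (a *: x) = a *: T x.
Proof. by move=> l; rewrite -[a *: x]addr0 l op0// addr0. Qed.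

Lemma opN T x : clinear T -> T (- x) = - T x.
Proof. by move=> l; rewrite -scaleN1r opZ// scaleN1r. Qed.

Lemma opB T x y : clinear T -> T (x - y) = T x - T y.
Proof. by move=> l; rewrite opD// opN. Qed.

Lemma op_sum T (I : Type) (s : seq I) (P : pred I) (F : I -> H) : clinear T ->
  T (\sum_(i <- s | P i) F i) = \sum_(i <- s | P i) T (F i).
Proof. by move=> l; exact: (big_morph T (fun x y => opD x y l) (op0 l)). Qed.

Lemma clinear_comp S T : clinear S -> clinear T -> clinear (S \o T).
Proof. by move=> lS lT a x y; rewrite /= lT lS. Qed.

Lemma clinear_iter T n : clinear T -> clinear (iter n T).
Proof. by move=> l; elim: n => [|n IH] a x y //=; rewrite IH l. Qed.

Definition contractive (T : H -> H) : Prop := forall x, nr (T x) <= nr x.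

Lemma contractive_comp S T : contractive S -> contractive T -> contractive (S \o T).
Proof. by move=> cS cT x; exact: le_trans (cS _) (cT _). Qed.

Lemma contractive_iter T n : contractive T -> contractive (iter n T).
Proof. by move=> c; elim: n => [|n IH] x //=; exact: le_trans (c _) (IH _). Qed.

Lemma op_contraction_clinear T : op_contraction T -> clinear T.
Proof. by case=> [[]]. Qed.

Lemma op_contraction_nr T : op_contraction T -> contractive T.
Proof. by case=> _ c x; rewrite -lecR !Re_normrK. Qed.

Lemma adjoint_rip T Ts x y : is_adjoint ip T Ts -> rip (T x) y = rip x (Ts y).
Proof. by move=> ad; rewrite /rip ad. Qed.

Lemma adjoint_iter T Ts n x y : is_adjoint ip T Ts ->
  ip (iter n T x) y = ip x (iter n Ts y).
Proof. by move=> ad; elim: n y => [|n IH] y //=; rewrite ad IH -iterSr. Qed.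

Lemma adjoint_clinear T Ts : is_adjoint ip T Ts -> clinear Ts.
Proof.
move=> ad a x y; apply: ip_inj => z; rewrite ipC [RHS]ipC; congr conjc.
by rewrite -ad !ipDr !ipZr !ad.
Qed.

(** One has $|T'x|^2 = \langle T T'x, x\rangle \le |T'x| |x|$; then divide by $|T'x|$. *)
Lemma adjoint_contractive T Ts :
  is_adjoint ip T Ts -> contractive T -> contractive Ts.
Proof.
move=> ad cT x; have [->|z0] := eqVneq (nr (Ts x)) 0; first exact: nr_ge0.
have zgt : 0 < nr (Ts x) by rewrite lt0r z0 nr_ge0.
rewrite -(ler_pM2l zgt) -expr2 -ripxx -(adjoint_rip _ _ ad).
by apply: le_trans (rip_le _ _) _; rewrite ler_wpM2r ?nr_ge0.
Qed.

Lemma cvgn_unique (f : R ^nat) (l l' : R) :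
  f @ \oo --> l -> f @ \oo --> l' -> l = l'.
Proof. by move=> h h'; apply: (@cvg_unique R _ _ _ l l' h h'); exact: norm_hausdorff. Qed.

(** * The quadratic form of an asymptotic limit *)

Section AsymptoticLimit.
Context (T A : H -> H).
Hypothesis hA : is_A_T ip T A.

Lemma A_cvg x y : (fun n => rip (iter n T x) (iter n T y)) @ \oo --> rip (A x) y.
Proof.
have [Ts [ad h]] := hA.
under eq_fun do rewrite ripC /rip (adjoint_iter _ _ _ ad) -/(rip _ _) ripC.
exact: cvg_ripl.
Qed.

Lemma A_sym x y : rip (A x) y = rip (A y) x.
Proof.
refine (cvgn_unique (@A_cvg x y) _).
by under eq_fun do rewrite ripC; exact: A_cvg.
Qed.

(** Replacing the arguments by their images shifts the sequence of [A_cvg] by one index, which does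
    not change its limit. *)
Lemma A_inv x y : rip (A (T x)) (T y) = rip (A x) y.
Proof.
refine (cvgn_unique (@A_cvg (T x) (T y)) _).
under eq_fun do rewrite -!iterSr.
by have := @A_cvg x y; rewrite -cvg_shiftS.
Qed.

Lemma A_cvg_sq x : (fun n => nr (iter n T x) ^+ 2) @ \oo --> rip (A x) x.
Proof. by under eq_fun do rewrite -ripxx; exact: A_cvg. Qed.

Lemma A_le_sq x : contractive T -> rip (A x) x <= nr x ^+ 2.
Proof.
move=> cT; apply: (ler_cvg_to (@A_cvg_sq x) (cvg_cst _)).
by apply: nearW => n; rewrite lerXn2r ?nnegrE ?nr_ge0//; exact: contractive_iter.
Qed.

Lemma A_add x y z : rip (A (x + y)) z = rip (A x) z + rip (A y) z.
Proof. by rewrite A_sym ripDr !(A_sym z). Qed.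

Lemma A_polar x y :
  rip (A x) y = (rip (A (x + y)) (x + y) - rip (A x) x - rip (A y) y) / 2.
Proof. by rewrite A_add !ripDr (A_sym y x); field. Qed.

(** [op_le] compares complex numbers, whose order requires equal imaginary parts. *)
Lemma A_real x : clinear T -> Im (ip (A x) x) = 0.
Proof.
move=> lT; rewrite Im_ip; refine (cvgn_unique (@A_cvg x _) _).
rewrite (_ : (fun n => _) = fun=> 0); first exact: cvg_cst.
apply/funext => n; rewrite opZ; last exact: clinear_iter.
by rewrite -Im_ip; case: hip => _ _ ->; rewrite -Re_normrK -rmorphXn.
Qed.

End AsymptoticLimit.

Lemma A_eq S T A B : is_A_T ip T A -> is_A_T ip S B ->
  (forall x, rip (A x) x = rip (B x) x) -> A = B.
Proof.
move=> hA hB AB; apply/funext => x; apply: rip_inj => y.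
by rewrite (A_polar hA) (A_polar hB) !AB.
Qed.

Lemma op_leP S T A B : is_A_T ip T A -> is_A_T ip S B -> clinear S -> clinear T ->
  (forall x, rip (A x) x <= rip (B x) x) -> op_le ip A B.
Proof.
by move=> hA hB lS lT AB x; rewrite lecE (A_real hA)// (A_real hB)// eqxx AB.
Qed.

(** By commutation $(ST)^n x = S^n T^n x$, whose norm is at most $|T^n x|$. *)
Lemma A_comp_le S T A B : S \o T = T \o S -> contractive S ->
  is_A_T ip (S \o T) A -> is_A_T ip T B -> forall x, rip (A x) x <= rip (B x) x.
Proof.
move=> ST cS hA hB x.
apply: (ler_cvg_to (@A_cvg_sq _ _ hA x) (@A_cvg_sq _ _ hB x)).
apply: nearW => n; rewrite (_ : iter n (S \o T) x = iter n S (iter n T x)).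
  by rewrite lerXn2r ?nnegrE ?nr_ge0//; exact: contractive_iter.
have TS y m : T (iter m S y) = iter m S (T y).
  by elim: m => //= m <-; have := congr1 (@^~ (iter m S y)) ST; rewrite /= => ->.
by elim: n => //= n ->; rewrite TS.
Qed.

(** The form of the common limit [A] is invariant under both factors, hence under $T_1T_2$. Its
    value at [x] is therefore its value at $(T_1T_2)^n x$, which is at most $|(T_1T_2)^n x|^2$. *)
Lemma A_comp_ge T1 T2 A A12 : contractive T1 -> contractive T2 ->
  is_A_T ip T1 A -> is_A_T ip T2 A -> is_A_T ip (T1 \o T2) A12 ->
  forall x, rip (A x) x <= rip (A12 x) x.
Proof.
move=> c1 c2 h1 h2 h12 x.
apply: (ler_cvg_to (cvg_cst _) (@A_cvg_sq _ _ h12 x)).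
apply: nearW => n; apply: le_trans (A_le_sq h1 _ c1).
suff -> : rip (A (iter n (T1 \o T2) x)) (iter n (T1 \o T2) x) = rip (A x) x by [].
by elim: n => //= n IH; rewrite (A_inv h1) (A_inv h2).
Qed.

(** * Vector-valued trigonometric polynomials *)

Definition trigv (I : finType) (n m : I -> nat) (x : I -> H) t : H :=
  \sum_i (cis t ^+ n i * (cis t)^*%C ^+ m i) *: x i.

Lemma rip_trigv (I J : finType) (n m : I -> nat) (k l : J -> nat)
    (x : I -> H) (y : J -> H) t :
  rip (trigv n m x t) (trigv k l y t) =
  Re (\sum_(p : I * J) ip (x p.1) (y p.2) *
       (cis t ^+ (n p.1 + l p.2) * (cis t)^*%C ^+ (m p.1 + k p.2))).
Proof.
rewrite /rip /trigv; move: (cis t) => e.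
rewrite ip_suml -(pair_bigA _ (fun i j => ip (x i) (y j) *
       (e ^+ (n i + l j) * e^*%C ^+ (m i + k j)))) /=.
congr Re; apply: eq_bigr => i _; rewrite ip_sumr; apply: eq_bigr => j _.
rewrite ipZl ipZr rmorphM/= !rmorphXn/= conjcK !exprD; ring.
Qed.

Lemma continuous_rip_trigv (I J : finType) (n m : I -> nat) (k l : J -> nat)
    (x : I -> H) (y : J -> H) :
  continuous (fun t => rip (trigv n m x t) (trigv k l y t)).
Proof. by under eq_fun do rewrite rip_trigv; exact: continuous_Re_trig. Qed.

(** Parseval's identity: the condition on the exponents is $n_i - m_i = k_j - l_j$ written without
    subtraction. *)
Lemma cint_rip_trigv (I J : finType) (n m : I -> nat) (k l : J -> nat)
    (x : I -> H) (y : J -> H) :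
  cint (fun t => rip (trigv n m x t) (trigv k l y t)) =
  2 * pi * \sum_i \sum_(j | (n i + l j == m i + k j)%N) rip (x i) (y j).
Proof.
under eq_fun do rewrite rip_trigv; rewrite cint_Re_trig; congr (_ * _).
rewrite Re_sum [RHS](eq_bigr (fun i =>
  \sum_j if (n i + l j == m i + k j)%N then rip (x i) (y j) else 0)); last first.
  by move=> i _; rewrite big_mkcond.
by rewrite pair_bigA big_mkcond.
Qed.

Lemma op_trigv (I : finType) (n m : I -> nat) (x : I -> H) t (T : H -> H) : clinear T ->
  T (trigv n m x t) = trigv n m (T \o x) t.
Proof. by move=> lT; rewrite /trigv op_sum//; apply: eq_bigr => i _; rewrite opZ. Qed.

Definition pv (c : nat -> R[i]) N (T : H -> H) x : H :=
  \sum_(j < N) c j *: iter j T x.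

Lemma nr_unit a x : csq a = 1 -> nr (a *: x) = nr x.
Proof. by move=> a1; rewrite nrZ Re_norm_csq a1 sqrtr1 mul1r. Qed.

Lemma csq_cisX (t : R) n : csq (cis t ^+ n) = 1.
Proof. by rewrite cisX csq_cis. Qed.

Lemma csq_conj_cisX (t : R) n : csq ((cis t)^*%C ^+ n) = 1.
Proof. by rewrite conj_cis csq_cisX. Qed.

(** * Energy estimates *)

Section Toeplitz.
Context (T Ts A : H -> H).
Hypotheses (lT : clinear T) (lA : clinear A) (ad : is_adjoint ip T Ts).
Hypotheses (cTs : contractive Ts) (cT : contractive T) (cA : contractive A).
Hypothesis TsAT : forall x, Ts (A (T x)) = A x.

Let D x := x - T (Ts x).
Let lTs : clinear Ts. Proof. exact: adjoint_clinear ad. Qed.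

Let dl x y := rip (D x) y.

Let dlE x y : dl x y = rip x y - rip (Ts x) (Ts y).
Proof. by rewrite /dl /D ripBl (adjoint_rip _ _ ad). Qed.

Let lD : clinear D.
Proof. by move=> a x y; rewrite /D lTs lT scalerBr opprD addrACA. Qed.

Lemma iter_TsAT m x : iter m Ts (A (iter m T x)) = A x.
Proof. by elim: m x => //= m IH x; rewrite -iterS iterSr TsAT IH. Qed.

(** The form [dl] is paired between $e^{i(N+q)t} y$ and $\sum_n e^{int} h_n$, weighted by $|p|^2 -
    1$. The parameter [r] is free: once the defect tends to 0 the right side no longer depends on
    it, while the left side is linear in it. *)
Lemma toeplitz_bound c N q y w (r : R) : 0 < r ->
  4 * pi * r * (rip (iter q T (pv c N T (D y))) (A (pv c N T w))
            - rip (iter q T (D y)) (A w)) <=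
  r ^+ 2 * nr y ^+ 2 * defect c N + 2 * pi * nr w ^+ 2.
Proof.
move=> r0.
(* The two-sided sequence of the overview, moved by [N] so that all indices are natural. The length
   [L] covers every index [N + q + j - k] that the pairing can hit. *)
pose h n := iter n Ts (A (iter N T w)).
pose L := (N + q + N).+1.
pose g t := csq (cpoly c N (cis t)) - 1.
pose Hh := trigv (fun n : 'I_L => n : nat) (fun=> 0%N) h.
pose Y t := cis t ^+ (N + q) *: y.
have hE j k : (k <= N)%N -> h (N + q + j - k)%N = iter (q + j) Ts (A (iter k T w)).
  move=> kN; rewrite /h -{2}(subnK kN) iterD.
  rewrite (_ : N + q + j - k = (q + j) + (N - k))%N; last first.
    by rewrite -addnA addnC addnBA.
  by rewrite iterD iter_TsAT.
have pt t : 2 * r * (g t * dl (Y t) (Hh t)) <=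
    r ^+ 2 * nr y ^+ 2 * g t ^+ 2 + dl (Hh t) (Hh t).
  have dpos x : 0 <= dl x x.
    by rewrite dlE !ripxx subr_ge0 lerXn2r ?nnegrE ?nr_ge0.
  have dsym x z : dl x z = dl z x by rewrite !dlE ripC [rip (Ts x) _]ripC.
  (* AM-GM for the nonnegative form [dl] *)
  have := dpos ((r * g t)%:C *: Y t - Hh t).
  have dYY : dl (Y t) (Y t) <= nr y ^+ 2.
    rewrite dlE !ripxx (@nr_unit (cis t ^+ _)) ?csq_cisX//.
    by rewrite lerBlDr lerDl sqr_ge0.
  have -> : dl ((r * g t)%:C *: Y t - Hh t) ((r * g t)%:C *: Y t - Hh t) =
     (r * g t) ^+ 2 * dl (Y t) (Y t) - 2 * (r * g t) * dl (Y t) (Hh t) + dl (Hh t) (Hh t).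
    rewrite {1}/dl opB// opZ// ripBl !ripBr !ripZl !ripZr.
    rewrite -/(dl _ _) -/(dl _ _) -/(dl _ _) -/(dl _ _).
    by rewrite (dsym (Hh t) (Y t)); ring.
  have : (r * g t) ^+ 2 * dl (Y t) (Y t) <= (r * g t) ^+ 2 * nr y ^+ 2.
    by rewrite ler_wpM2l ?sqr_ge0.
  move: (dl _ _) (dl _ _) (dl _ _) => *; nra.
(* Expanding $|p|^2 = \sum_{j,k} c_j \bar c_k e^{i(j-k)t}$ makes the weighted vector a trigonometric
   polynomial, [Z1]; the term $-1$ gives [Z2]. *)
pose y1 (p : 'I_N * 'I_N) := (c p.1 * (c p.2)^*%C) *: D y.
pose Z1 := trigv (fun p : 'I_N * 'I_N => p.1 + (N + q))%N (fun p => p.2 : nat) y1.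
pose Z2 := trigv (fun _ : 'I_1 => N + q)%N (fun=> 0%N) (fun=> D y).
have Z1E t : Z1 t = (csq (cpoly c N (cis t)))%:C *: (cis t ^+ (N + q) *: D y).
  rewrite /Z1 /trigv; move: (cis t) => e.
  rewrite -mulcJ /cpoly rmorph_sum/= mulr_suml scaler_suml.
  rewrite -(pair_bigA _ (fun j k : 'I_N => (e ^+ (j + (N + q)) * e^*%C ^+ k) *: y1 (j, k))).
  apply: eq_bigr => j _; rewrite mulr_sumr scaler_suml; apply: eq_bigr => k _.
  rewrite /y1 !scalerA rmorphM/= rmorphXn/= exprD; congr (_ *: _); ring.
have Z2E t : Z2 t = cis t ^+ (N + q) *: D y.
  by rewrite /Z2 /trigv big_ord1 expr0 mulr1.
have gE t : g t * dl (Y t) (Hh t) = rip (Z1 t) (Hh t) - rip (Z2 t) (Hh t).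
  by rewrite Z1E Z2E ripZl /g /dl /Y opZ//; ring.
(* The frequency [N + q + j - k] selects $h_{N+q+j-k} = T'^{q+j} A T^k w$; moving $T'^{q+j}$ to the
   other side reassembles the two values of the polynomial at [T]. *)
have I1 : cint (fun t => g t * dl (Y t) (Hh t)) =
   2 * pi * (rip (iter q T (pv c N T (D y))) (A (pv c N T w)) - rip (iter q T (D y)) (A w)).
  under eq_fun do rewrite gE -mulN1r.
  rewrite cintD ?cintZ ?cint_rip_trigv; last 3 first.
  - exact: continuous_rip_trigv.
  - exact: continuous_rip_trigv.
  - by move=> t; apply: cvgM; [exact: cvg_cst|exact: continuous_rip_trigv].
  rewrite mulN1r -mulrBr; congr (_ * (_ - _)).
  - rewrite -(pair_bigA _ (fun j k : 'I_N => \sum_(n < L | (j + (N + q) + 0 == k + n)%N)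
      rip (y1 (j, k)) (h n))) /= /pv.
    rewrite op_sum//; last exact: clinear_iter.
    rewrite op_sum// /rip ip_suml Re_sum; apply: eq_bigr => j _.
    rewrite ip_sumr Re_sum; apply: eq_bigr => k _.
    have kL : (N + q + j - k < L)%N.
      by rewrite ltnS; apply: leq_trans (leq_subr _ _) _; rewrite leq_add2l ltnW.
    have kle : (k <= N + q + j)%N.
      by apply: leq_trans (ltnW (ltn_ord k)) _; rewrite -addnA leq_addr.
    rewrite (big_pred1 (Ordinal kL)) => [|n]; last first.
      by rewrite /= -val_eqE/= -(eqn_add2l k n) subnKC// addn0 addnC eq_sym.
    rewrite hE ?(ltnW (ltn_ord k))// !opZ//; last exact: clinear_iter.
    rewrite /y1 /= !ipZl ipZr mulrA -iterD; congr Re; congr (_ * _).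
    by rewrite (adjoint_iter _ _ _ ad).
  - have qL : (N + q < L)%N by rewrite ltnS leq_addr.
    rewrite big_ord1 (big_pred1 (Ordinal qL)) => [|n]; last first.
      by rewrite /= -val_eqE/= addn0 add0n eq_sym.
    have := hE 0%N 0%N (leq0n _); rewrite /= addn0 subn0 addn0 => ->.
    by rewrite /rip (adjoint_iter _ _ _ ad).
(* As $h_{n+1} = T' h_n$, the energy telescopes to $|h_0|^2 - |h_L|^2 \le |w|^2$. *)
have I2 : cint (fun t => dl (Hh t) (Hh t)) <= 2 * pi * nr w ^+ 2.
  under eq_fun do rewrite dlE /Hh op_trigv// -mulN1r.
  rewrite cintD ?cintZ ?cint_rip_trigv; last 3 first.
  - exact: continuous_rip_trigv.
  - exact: continuous_rip_trigv.
  - by move=> t; apply: cvgM; [exact: cvg_cst|exact: continuous_rip_trigv].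
  rewrite mulN1r -mulrBr -sumrB ler_wpM2l ?mulr_ge0 ?pi_ge0//.
  rewrite (eq_bigr (fun n : 'I_L => nr (h n) ^+ 2 - nr (h n.+1) ^+ 2)); last first.
    by move=> n _; rewrite !(big_pred1 n) ?ripxx// => m; rewrite addn0 add0n eq_sym.
  rewrite -(big_mkord xpredT (fun n => nr (h n) ^+ 2 - nr (h n.+1) ^+ 2)).
  rewrite -[X in X <= _]opprK -sumrN.
  rewrite (eq_bigr (fun n => nr (h n.+1) ^+ 2 - nr (h n) ^+ 2)); last first.
    by move=> *; rewrite opprB.
  rewrite telescope_sumr// opprB lerBlDr ler_wpDr ?sqr_ge0//.
  rewrite lerXn2r ?nnegrE ?nr_ge0// /h /=.
  exact: le_trans (cA _) (contractive_iter _ cT _).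
have ch : continuous (fun t => dl (Hh t) (Hh t)).
  by under eq_fun do rewrite /dl /Hh op_trigv//; exact: continuous_rip_trigv.
have cgd : continuous (fun t => g t * dl (Y t) (Hh t)).
  move=> t; under eq_fun do rewrite gE.
  by apply: cvgB; exact: continuous_rip_trigv.
have := le_cint _ _ pt.
rewrite cintZ// I1 cintD//; last first.
  by move=> t; apply: cvgM; [exact: cvg_cst|exact: continuous_defect].
rewrite cintZ; last exact: continuous_defect.
rewrite -/(defect c N).
set lhs := _ - _; set K1 := cint _ in I2 *.
rewrite (_ : 2 * r * _ = 4 * pi * r * lhs); last by ring.
move=> h1; apply: le_trans (h1 _ _) _.
- by move=> t; apply: cvgM; [exact: cvg_cst|exact: cgd].
- move=> t; apply: cvgD; last exact: ch.
  by apply: cvgM; [exact: cvg_cst|exact: continuous_defect].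
- by rewrite lerD2l.
Qed.

End Toeplitz.

Lemma nrZ_sq a x : nr (a *: x) ^+ 2 = csq a * nr x ^+ 2.
Proof. by rewrite nrZ exprMn csqE. Qed.

Lemma continuous_nr_trigv (I : finType) (n m : I -> nat) (x : I -> H) :
  continuous (fun t => nr (trigv n m x t) ^+ 2).
Proof. by under eq_fun do rewrite -ripxx; exact: continuous_rip_trigv. Qed.

Lemma cint_nr_trigv L (x : nat -> H) :
  cint (fun t => nr (trigv (fun=> 0%N) (fun n : 'I_L => n : nat) x t) ^+ 2) =
  2 * pi * \sum_(n < L) nr (x n) ^+ 2.
Proof.
under eq_fun do rewrite -ripxx; rewrite cint_rip_trigv; congr (_ * _).
by apply: eq_bigr => n _; rewrite (big_pred1 n) ?ripxx// => m; rewrite add0n addn0.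
Qed.

Lemma sum_sq_telescope T x L :
  \sum_(0 <= n < L) (nr (iter n T x) ^+ 2 - nr (T (iter n T x)) ^+ 2) =
  nr x ^+ 2 - nr (iter L T x) ^+ 2.
Proof.
elim: L => [|L IH]; first by rewrite big_geq//= subrr.
by rewrite big_nat_recr//= IH addrA subrK.
Qed.

(** * A von Neumann inequality with remainder for strict contractions *)

Section VonNeumann.
Context (T : H -> H) (rho : R).
Hypotheses (lT : clinear T) (rho01 : 0 <= rho < 1).
Hypothesis Trho : forall x, nr (T x) <= rho * nr x.

Let cT : contractive T.
Proof.
move=> x; apply: le_trans (Trho x) _; rewrite -[leRHS]mul1r.
by rewrite ler_wpM2r ?nr_ge0// ltW//; case/andP: rho01.
Qed.

Let nr_iter n x : nr (iter n T x) <= rho ^+ n * nr x.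
Proof.
case/andP: rho01 => r0 r1; elim: n => [|n IH]; first by rewrite mul1r.
by apply: le_trans (Trho _) _; rewrite exprS -mulrA ler_wpM2l.
Qed.

Let dl x := nr x ^+ 2 - nr (T x) ^+ 2.

Let dl_ge0 x : 0 <= dl x.
Proof. by rewrite subr_ge0 lerXn2r ?nnegrE ?nr_ge0. Qed.

Let pos_prefix (F : nat -> R) m n : (m <= n)%N -> (forall i, 0 <= F i) ->
  \sum_(0 <= i < m) F i <= \sum_(0 <= i < n) F i.
Proof.
move=> mn F0; rewrite (@big_cat_nat _ _ _ m 0 n)//= lerDl.
by apply: sumr_ge0.
Qed.

(* The summand at [n] on the left is the coefficient of [e^(N - n)] in
   [p(e) sum_k e^-k T^k x]; the shift by [N] keeps the exponents in [nat]. *)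
Lemma cauchy_product (c : nat -> R[i]) N K x (e : R[i]) : e * e^*%C = 1 ->
  let w m := if (N <= m < N + K)%N then iter (m - N) T x else 0 in
  \sum_(n < N + K) (e ^+ 0 * e^*%C ^+ n) *: (\sum_(j < N) c j *: w (n + j)%N) =
  (e^*%C ^+ N * cpoly c N e) *: \sum_(k < K) (e ^+ 0 * e^*%C ^+ k) *: iter k T x.
Proof.
move=> ee w; under eq_bigr do rewrite scaler_sumr.
rewrite exchange_big/= /cpoly mulr_sumr scaler_suml; apply: eq_bigr => j _.
rewrite -(big_mkord xpredT (fun n => (e ^+ 0 * e^*%C ^+ n) *: (c j *: w (n + j)%N))).
have jN : (j < N)%N := ltn_ord j.
(* For [n < N - j] the window [w] has not begun, and after the shift by [N - j] it has ended for
   indices from [K] on; exactly [K] terms survive. *)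
rewrite (@big_cat_nat _ _ _ (N - j))//=; last first.
  by apply: leq_trans (leq_subr _ _) (leq_addr _ _).
rewrite big_nat_cond big1 ?add0r => [|n /andP[/andP[_ nN] _]]; last first.
  by rewrite /w leqNgt addnC -ltn_subRL nN /= !scaler0.
rewrite -{1}(add0n (N - j)%N) big_addn.
have -> : (N + K - (N - j) = K + j)%N.
  by rewrite subnBA ?(ltnW jN)// -addnA addKn.
rewrite (@big_cat_nat _ _ _ K)//=; last exact: leq_addr.
rewrite [X in _ + X]big_nat_cond [X in _ + X]big1 ?addr0 => [|n]; last first.
  move=> /andP[/andP[Kn _] _].
  rewrite /w -addnA subnK ?(ltnW jN)// [(n + N)%N]addnC ltn_add2l ltnNge Kn andbF.
  by rewrite !scaler0.
rewrite big_mkord scaler_sumr; apply: eq_bigr => k _.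
rewrite /w -addnA subnK ?(ltnW jN)// [(k + N)%N]addnC ltn_add2l ltn_ord leq_addr addKn.
rewrite !scalerA; congr (_ *: _).
have -> : e^*%C ^+ (k + (N - j)) = e^*%C ^+ k * e^*%C ^+ N * e ^+ j.
  rewrite exprD -mulrA; congr (_ * _).
  have -> : e^*%C ^+ N = e^*%C ^+ (N - j) * e^*%C ^+ j by rewrite -exprD subnK// ltnW.
  by rewrite -mulrA -exprMn [X in X ^+ j]mulrC ee expr1n mulr1.
by ring.
Qed.

(** The energies of the Fourier coefficients [G n] are all nonnegative. Those at $N + s$ with $s <
    Q$ are the energies of $T^s p(T) y$ and telescope; the one at $N - i$, which is distinct from
    them since $i > 0$, is the energy of $p_i(T) y$. *)
Lemma von_neumann_bound_iter c N Q y (r : R) i : 0 < r -> (0 < i <= N)%N ->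
  2 * pi * (nr (pv c N T y) ^+ 2 - nr (iter Q T (pv c N T y)) ^+ 2 +
    dl (pv (fun j => c (i + j)%N) (N - i) T y)) <=
  2 * pi * nr y ^+ 2 + (nr y / (1 - rho)) ^+ 2 * (r * defect c N + 2 * pi / r).
Proof.
move=> r0 /andP[i0 iN]; set p := pv c N T y.
case/andP: rho01 => rho0 rho1.
(* Long enough for [G (N + s)], with [s < Q], to involve no truncated term. *)
pose K := (Q + N)%N.
pose w m := if (N <= m < N + K)%N then iter (m - N) T y else 0.
pose G n := \sum_(j < N) c j *: w (n + j)%N.
pose gv := trigv (fun=> 0%N) (fun k : 'I_K => k : nat) (fun k => iter k T y).
pose Gv := trigv (fun=> 0%N) (fun n : 'I_(N + K) => n : nat) (fun n => G n).
pose B := (nr y / (1 - rho)) ^+ 2.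
pose g t := csq (cpoly c N (cis t)) - 1.
have GvE t : Gv t = ((cis t)^*%C ^+ N * cpoly c N (cis t)) *: gv t.
  by apply: cauchy_product; rewrite mulcJ csq_cis.
have dlG t : dl (Gv t) = csq (cpoly c N (cis t)) * dl (gv t).
  by rewrite /dl GvE opZ// !nrZ_sq csqM csq_conj_cisX mul1r mulrBr.
have gvB t : dl (gv t) <= B.
  rewrite /dl lerBlDr ler_wpDr ?sqr_ge0//.
  rewrite lerXn2r ?nnegrE ?nr_ge0 ?divr_ge0 ?nr_ge0 ?subr_ge0 ?(ltW rho1)//.
  apply: le_trans (ler_nr_sum _ _ _) _.
  apply: (@le_trans _ _ (\sum_(k < K) rho ^+ k * nr y)).
    by apply: ler_sum => k _; rewrite nr_unit ?expr0 ?mul1r ?csq_conj_cisX.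
  rewrite -mulr_suml [leRHS]mulrC ler_wpM2r ?nr_ge0//.
  rewrite -[leRHS]mul1r ler_pdivlMr ?subr_gt0// mulrC -opprB mulNr -subrX1 opprB.
  by rewrite lerBlDr lerDl exprn_ge0.
have pt t : dl (Gv t) <= dl (gv t) + B * (r * g t ^+ 2 + r^-1).
  have rV : 0 < r^-1 by rewrite invr_gt0.
  rewrite dlG -[csq _](subrK 1) -/(g t) mulrDl mul1r addrC lerD2l.
  have B0 : 0 <= B by rewrite sqr_ge0.
  (* This form of the inequality between means trades the first power of [g] for its square, which
     the defect controls. *)
  have gle : `|g t| <= r * g t ^+ 2 + r^-1.
    rewrite -(ler_pM2l r0) mulrDr divff ?gt_eqF// -(real_normK (num_real (g t))).
    move: (normr_ge0 (g t)); move: `|g t| => z z0.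
    have := sqr_ge0 (r * z - 1); nra.
  apply: le_trans (_ : `|g t| * B <= _); last by rewrite mulrC ler_wpM2l.
  apply: le_trans (ler_norm _) _; rewrite normrM ler_wpM2l// ger0_norm ?dl_ge0//.
have cdl (L : nat) (x : 'I_L -> H) : continuous
    (fun t => dl (trigv (fun=> 0%N) (fun n : 'I_L => n : nat) x t)).
  move=> t; under eq_fun do rewrite /dl op_trigv//.
  by apply: cvgB; exact: continuous_nr_trigv.
have idl (L : nat) (x : nat -> H) :
    cint (fun t => dl (trigv (fun=> 0%N) (fun n : 'I_L => n : nat) (fun n => x n) t)) =
    2 * pi * \sum_(0 <= n < L) dl (x n).
  under eq_fun do rewrite /dl op_trigv// -mulN1r.
  rewrite cintD ?cintZ; last 3 first.
  - exact: continuous_nr_trigv.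
  - exact: continuous_nr_trigv.
  - by move=> t; apply: cvgM; [exact: cvg_cst|exact: continuous_nr_trigv].
  by rewrite !cint_nr_trigv (cint_nr_trigv L (T \o x)) mulN1r -mulrBr -sumrB big_mkord.
have lower : nr p ^+ 2 - nr (iter Q T p) ^+ 2 +
    dl (pv (fun j => c (i + j)%N) (N - i) T y) <= \sum_(0 <= n < N + K) dl (G n).
  rewrite (@big_cat_nat _ _ _ N)//=; last exact: leq_addr.
  rewrite [leLHS]addrC; apply: lerD.
    have Ni : (N - i < N)%N by rewrite ltn_subrL i0 (leq_trans i0).
    rewrite big_mkord (bigD1 (Ordinal Ni))//=.
    have -> : pv (fun j => c (i + j)%N) (N - i) T y = G (N - i)%N.
      rewrite /pv /G -(big_mkord xpredT (fun j => c j *: w (N - i + j)%N)).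
      rewrite (@big_cat_nat _ _ _ i)//= [X in _ = X + _]big_nat_cond.
      rewrite [X in _ = X + _]big1 ?add0r => [|j /andP[/andP[_ ji] _]]; last first.
        by rewrite /w leqNgt -ltn_subRL subKn// ji /= scaler0.
      rewrite [RHS](_ : _ = \sum_(0 <= j < N - i)
        c (j + i)%N *: w (N - i + (j + i))%N); last first.
        by rewrite -{1}(add0n i) big_addn.
      rewrite big_mkord; apply: eq_bigr => j _.
      have jlt : (j < N - i)%N := ltn_ord j.
      rewrite /w [(N - i + _)%N]addnC -addnA subnKC// leq_addl addnK.
      rewrite [(j + N)%N]addnC ltn_add2l.
      rewrite (_ : (j < K)%N) ?[(i + j)%N]addnC//.
      by apply: leq_trans jlt _; apply: leq_trans (leq_subr _ _) (leq_addl _ _).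
    by rewrite lerDl; apply: sumr_ge0.
  rewrite -{1}(add0n N) big_addn addKn.
  apply: le_trans (pos_prefix (leq_addr N Q) _); last by [].
  rewrite -sum_sq_telescope le_eqVlt; apply/orP; left; apply/eqP.
  rewrite big_nat_cond [RHS]big_nat_cond; apply: eq_bigr => s /andP[/andP[_ sQ] _].
  rewrite -/(dl _); congr dl; rewrite /p /pv op_sum; last exact: clinear_iter.
  apply: eq_bigr => j _; rewrite opZ; last exact: clinear_iter.
  rewrite /w -iterD -addnA addnCA leq_addr ltn_add2l /K addKn.
  by rewrite (_ : (s + j < Q + N)%N)// -addSn leq_add// ltnW.
have cd : continuous (fun t => g t ^+ 2) := @continuous_defect R c N.
have crd : continuous (fun t => r * g t ^+ 2).
  by move=> t; apply: cvgM; [exact: cvg_cst|exact: cd].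
have cc : continuous (fun _ : R => r^-1) by move=> t; exact: cvg_cst.
have cgd : continuous (fun t => r * g t ^+ 2 + r^-1).
  by move=> t; apply: cvgD; [exact: crd|exact: cc].
have cBg : continuous (fun t => B * (r * g t ^+ 2 + r^-1)).
  by move=> t; apply: cvgM; [exact: cvg_cst|exact: cgd].
have cgv : continuous (fun t => dl (gv t)) by exact: cdl.
have csum : continuous (fun t => dl (gv t) + B * (r * g t ^+ 2 + r^-1)).
  by move=> t; apply: cvgD; [exact: cgv|exact: cBg].
have := le_cint (@cdl _ _) csum pt.
rewrite idl (@cintD _ (fun t => dl (gv t)) (fun t => B * (r * g t ^+ 2 + r^-1)))//.
rewrite (@cintZ _ B (fun t => r * g t ^+ 2 + r^-1))//.
rewrite (@cintD _ (fun t => r * g t ^+ 2) (fun=> r^-1))//.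
rewrite (@cintZ _ r (fun t => g t ^+ 2))// cint_cst.
rewrite (idl K (fun k => iter k T y)) sum_sq_telescope -/(defect c N) => h.
apply: le_trans (_ : 2 * pi * \sum_(0 <= n < N + K) dl (G n) <= _).
  by rewrite ler_wpM2l// mulr_ge0 ?pi_ge0.
apply: le_trans h _; rewrite [_^-1 * _]mulrC lerD2r ler_wpM2l// ?mulr_ge0 ?pi_ge0//.
by rewrite lerBlDr lerDl sqr_ge0.
Qed.

(** Let [Q] tend to infinity: the subtracted term is at most $(\rho^Q |p(T) y|)\,|p(T) y|$ and
    vanishes because $\rho < 1$. *)
Lemma von_neumann_bound c N y (r : R) i : 0 < r -> (0 < i <= N)%N ->
  2 * pi * (nr (pv c N T y) ^+ 2 + dl (pv (fun j => c (i + j)%N) (N - i) T y)) <=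
  2 * pi * nr y ^+ 2 + (nr y / (1 - rho)) ^+ 2 * (r * defect c N + 2 * pi / r).
Proof.
move=> r0 iN; case/andP: rho01 => rho0 rho1.
set p := pv c N T y.
have p0 : (fun Q => nr (iter Q T p) ^+ 2) @ \oo --> 0.
  have e0 : (fun Q => (rho ^+ Q * nr p) * nr p) @ \oo --> 0.
    rewrite -(mul0r (nr p)) -{1}(mul0r (nr p)); apply: cvgM; last exact: cvg_cst.
    by apply: cvgM; [apply: cvg_expr; rewrite ger0_norm|exact: cvg_cst].
  apply: (squeeze_cvgr _ (cvg_cst _) e0); apply: nearW => Q.
  rewrite sqr_ge0 expr2 ler_pM ?nr_ge0// ?nr_iter//.
  exact: contractive_iter.
apply: (@ler_cvg_to _ \oo _ R (fun Q => 2 * pi * (nr p ^+ 2 - nr (iter Q T p) ^+ 2 +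
    dl (pv (fun j => c (i + j)%N) (N - i) T y))) _ _ _ _ (cvg_cst _)).
  apply: cvgM; first exact: cvg_cst.
  apply: cvgD; last exact: cvg_cst.
  by rewrite -[X in _ --> X]subr0; apply: cvgB => //; exact: cvg_cst.
by apply: nearW => Q; exact: von_neumann_bound_iter.
Qed.

End VonNeumann.

(** * Limits in both arguments and operator properties of the asymptotic limit *)

Lemma cvg_rip2 {I : Type} (F : set_system I) {FF : Filter F} (f g : I -> H) x y :
  f @ F --> x -> g @ F --> y -> (fun i => rip (f i) (g i)) @ F --> rip x y.
Proof.
have polar v w : rip v w = (nr (v + w) ^+ 2 - nr v ^+ 2 - nr w ^+ 2) / 2.
  by rewrite -!ripxx !ripDl !ripDr (ripC w v); field.
have cnr2 (h : I -> H) z : h @ F --> z -> (fun i => nr (h i) ^+ 2) @ F --> nr z ^+ 2.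
  by move=> /cvg_nr c; under eq_fun do rewrite expr2; rewrite expr2; exact: cvgM.
move=> fx gy; rewrite polar; under eq_fun do rewrite polar.
apply: cvgM; last exact: cvg_cst.
by apply: cvgB; [apply: cvgB|]; apply: cnr2 => //; exact: cvgD.
Qed.

Lemma cvg_contractive {I : Type} (F : set_system I) {FF : Filter F} (f : I -> H) x S :
  clinear S -> contractive S -> f @ F --> x -> (fun i => S (f i)) @ F --> S x.
Proof.
move=> lS cS /cvg_nrP h; apply/cvg_nrP => e /h; apply: filterS => i.
by rewrite -(@opB S)//; exact: le_lt_trans.
Qed.

Lemma closed_eq_contractive F G : clinear F -> contractive F -> clinear G ->
  contractive G -> closed [set z : H | F z = G z].
Proof.
move=> lF cF lG cG z hz; apply/subr0_eq/nr_eq0/eqP.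
rewrite eq_le nr_ge0 andbT; apply/ler_addgt0Pl => e e0; rewrite addr0.
have e20 : 0 < (e / 2)%:C :> R[i] by rewrite ltcR divr_gt0.
have [z' [/= FG]] := hz _ (nbhsx_ballx z _ e20).
rewrite -ball_normE /= normc_lt -[Re _]/(nr _) => zz'.
have -> : F z - G z = F (z - z') + G (z' - z).
  by rewrite (@opB F)// (@opB G)// FG addrA subrK.
apply: le_trans (ler_nrD _ _) _; rewrite (splitr e) lerD//.
  exact: le_trans (cF _) (ltW zz').
by apply: le_trans (cG _) _; rewrite nrB ltW.
Qed.

Lemma adjoint_clinear_left T Ts : is_adjoint ip T Ts -> clinear T.
Proof.
by move=> ad a x y; apply: ip_inj => z; rewrite ad !(ipDl, ipZl) !ad.
Qed.

Section LimitOperator.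
Context (T Ts A : H -> H).
Hypotheses (lT : clinear T) (cT : contractive T).
Hypotheses (ad : is_adjoint ip T Ts) (hA : is_A_T ip T A).

Lemma A_clinear : clinear A.
Proof.
move=> b x y; apply: rip_inj => z.
refine (cvgn_unique (@A_cvg _ _ hA _ _) _).
have linT n : clinear (iter n T) by exact: clinear_iter.
under eq_fun do rewrite linT ripDl.
rewrite ripDl; apply: cvgD; last exact: A_cvg.
have -> : rip (b *: A x) z = rip (A x) (b^*%C *: z).
  by rewrite /rip ipZl ipZr conjcK.
rewrite (_ : (fun n => _) = fun n => rip (iter n T x) (iter n T (b^*%C *: z))).
  exact: A_cvg.
by apply/funext => n; rewrite (@opZ (iter n T))// /rip ipZl ipZr conjcK.
Qed.

Lemma A_TsAT x : Ts (A (T x)) = A x.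
Proof.
by apply: rip_inj => y; rewrite ripC -(adjoint_rip _ _ ad) ripC (A_inv hA).
Qed.

Lemma A_contractive : contractive A.
Proof.
move=> x; have [S [adS h]] := hA.
have cS := adjoint_contractive adS cT.
apply: (ler_cvg_to (cvg_nr (h x)) (cvg_cst _)); apply: nearW => n.
exact: le_trans (contractive_iter _ cS _) (contractive_iter _ cT _).
Qed.

End LimitOperator.

(** * Invariant forms and the unitary part *)

Section Unitary.
Context (T Ts B : H -> H).
Hypotheses (lT : clinear T) (cT : contractive T) (ad : is_adjoint ip T Ts).
Hypothesis (cnu : op_cnu ip T).
Hypothesis B_sym : forall x y, rip (B x) y = rip (B y) x.
Hypothesis B_inv : forall x y, rip (B (T x)) (T y) = rip (B x) y.
Hypothesis B_kill : forall q x y, rip (B (iter q T (x - T (Ts x)))) y = 0.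

Let lTs : clinear Ts. Proof. exact: adjoint_clinear ad. Qed.
Let cTs : contractive Ts. Proof. exact: adjoint_contractive ad cT. Qed.

Lemma cnu_invariant_eq0 x : B x = 0.
Proof.
(* By symmetry of [B], the hypothesis [B_kill] says that $(I - TT') T'^q B w$ is orthogonal to every
   vector. *)
have TTs q w : T (Ts (iter q Ts (B w))) = iter q Ts (B w).
  apply/eqP; rewrite eq_sym -subr_eq0; apply/eqP/rip_inj => y.
  rewrite {2}/rip ip0l /= -[RHS](B_kill q y w) B_sym.
  rewrite [RHS]ripC {2}/rip (adjoint_iter _ _ _ ad) -/(rip _ _).
  rewrite !ripBl (adjoint_rip _ _ ad) [rip y _]ripC; congr (_ - _).
  by rewrite [RHS](adjoint_rip _ _ ad) ripC.
have TsBT w : Ts (B (T w)) = B w.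
  by apply: rip_inj => y; rewrite ripC -(adjoint_rip _ _ ad) ripC B_inv.
have TB w : T (B w) = B (T w) by rewrite -TsBT (TTs 0%N).
have TnB n w : iter n T (B w) = B (iter n T w).
  by elim: n => //= n ->; rewrite TB.
(* The unitary part of [T]: along the forward and the backward orbit, [T] and [Ts] undo each other.
   It contains the range of [B]. *)
pose M := [set z | forall n, Ts (T (iter n T z)) = iter n T z /\
  T (Ts (iter n Ts z)) = iter n Ts z].
have MB w : M (B w) by move=> n; rewrite TTs TnB TB TsBT.
suff M0 : M = [set 0] by have := MB x; rewrite M0.
have linT n := clinear_iter n lT; have linTs n := clinear_iter n lTs.
have cnT n := @contractive_iter _ n cT; have cnTs n := @contractive_iter _ n cTs.
apply: (cnu ad).
- split.
  + move=> z hz n; split.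
      apply: (@closed_eq_contractive (Ts \o (T \o iter n T)) (iter n T)) => //.
      * exact/clinear_comp/clinear_comp.
      * exact/contractive_comp/contractive_comp.
      * by apply: closure_subset hz => y My; have [] := My n.
    apply: (@closed_eq_contractive (T \o (Ts \o iter n Ts)) (iter n Ts)) => //.
    * exact/clinear_comp/clinear_comp.
    * exact/contractive_comp/contractive_comp.
    * by apply: closure_subset hz => y My; have [] := My n.
  + by move=> n; rewrite (op0 (linT n)) (op0 (linTs n)) (op0 lT) (op0 lTs) (op0 lT).
  + move=> b z y Mz My n; have [z1 z2] := Mz n; have [y1 y2] := My n.
    by rewrite linT lT lTs z1 y1 linTs lTs lT z2 y2.
- move=> _ [z Mz <-] n; have [Tz _] := Mz 0%N; split.
    by have [h _] := Mz n.+1; rewrite -iterSr.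
  case: n => [|n]; first by rewrite /= Tz.
  by rewrite iterSr Tz; have [_] := Mz n.
- move=> _ [z Mz <-] n; have [_ Tz] := Mz 0%N; split; last first.
    by have [_ h] := Mz n.+1; rewrite -iterSr.
  case: n => [|n]; first by rewrite /= Tz.
  by rewrite iterSr Tz; have [] := Mz n.
- move=> z Mz; rewrite -(Re_normrK (T z)) -(Re_normrK z) -!/(nr _).
  have [Tz _] := Mz 0%N; congr (_%:C); apply/eqP.
  by rewrite -(@eqrXn2 _ 2) ?nr_ge0// -!ripxx (adjoint_rip _ _ ad) Tz.
- move=> z Mz; have [_ Tz] := Mz 0%N; exists (Ts z) => // n; split; last first.
    by have [_ h] := Mz n.+1; rewrite -iterSr.
  case: n => [|n]; first by rewrite /= Tz.
  by rewrite iterSr Tz; have [] := Mz n.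
Qed.

End Unitary.

(** * The functional calculus *)

Section FunctionalCalculus.
Context (T W : H -> H) (u : R[i]^o -> R[i]^o) (a : nat -> R[i]^o).
Hypotheses (lT : clinear T) (cT : contractive T).
Hypothesis au : forall z : R[i]^o, `|z| < 1 ->
  series (fun n => a n * z ^+ n) @ \oo --> u z.
Hypothesis hW : forall x, (fun r : R => limn (series (fun n =>
  ((a n : R[i]) * r%:C ^+ n) *: iter n T x))) @ 1^'- --> W x.
Context (N : nat -> nat).
Hypothesis kN : forall k, (k <= N k)%N.
Hypothesis Ntail : forall k N',
  \sum_(N k <= j < N') nr (a j) * radius k ^+ j <= k.+1%:R^-1.
Hypothesis Ndefect : (fun k => defect (rcoef a k) (N k)) @ \oo --> 0.

(** For [rho < 1] this is a strict contraction, to which the von Neumann bound applies. *)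
Definition scaled (rho : R) x := rho%:C *: T x.

Lemma iter_scaled rho n x : iter n (scaled rho) x = (rho ^+ n)%:C *: iter n T x.
Proof.
elim: n => [|n IH]; first by rewrite expr0 scale1r.
by rewrite /= IH /scaled (@opZ T)// scalerA -rmorphM -exprS.
Qed.

Lemma clinear_scaled rho : clinear (scaled rho).
Proof. by move=> b x y; rewrite /scaled lT scalerDr !scalerA mulrC. Qed.

Lemma pv_op c n rho x : pv c n (scaled rho) (T x) = T (pv c n (scaled rho) x).
Proof.
rewrite /pv op_sum//; apply: eq_bigr => j _.
by rewrite !iter_scaled (@opZ T)// (@opZ T)// -iterSr.
Qed.

Lemma nr_term k rho j x : 0 <= rho <= 1 ->
  nr (((a j : R[i]) * (radius k * rho)%:C ^+ j) *: iter j T x) <=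
  nr (a j) * radius k ^+ j * nr x.
Proof.
move=> /andP[rho0 rho1]; have /andP[k0 k1] : 0 <= (radius k : R) < 1 := radius_itv k.
rewrite nrZ -[Re _]/(nr (_ : R[i]^o)) nrM -rmorphXn nr_real ?exprn_ge0 ?mulr_ge0//.
rewrite exprMn; apply: ler_pM => //; rewrite ?mulr_ge0 ?nr_ge0 ?exprn_ge0//.
  rewrite ler_wpM2l ?nr_ge0// -[leRHS]mulr1 ler_wpM2l ?exprn_ge0//.
  exact: exprn_ile1.
exact: contractive_iter.
Qed.

Lemma cvg_term k rho x : 0 <= rho <= 1 -> cvgn (series (fun j =>
  ((a j : R[i]) * (radius k * rho)%:C ^+ j) *: iter j T x)).
Proof.
move=> h; apply: (@series_cvg_nr _ _ _ (fun j => nr (a j) * radius k ^+ j * nr x)).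
  by move=> n; exact: nr_term.
rewrite (_ : (fun j => _) = nr x *: (fun j => nr (a j) * radius k ^+ j)); last first.
  by apply/funext => j; rewrite mulrC.
apply: is_cvg_seriesZ.
exact: nr_series_cvg au _ (radius_itv k).
Qed.

(** Up to a small tail, $p_k(\rho T) x$ is the Abel mean at radius $r_k \rho$. The margin [d]
    precedes [rho], and [k] comes last, so a later choice of [k] can absorb constants that blow up
    as $\rho \to 1$. *)
Lemma approx_W x (e : R) : 0 < e -> exists2 d : R, 0 < d <= 1 &
  forall rho, 1 - d < rho <= 1 ->
  \forall k \near \oo, nr (W x - pv (rcoef a k) (N k) (scaled rho) x) < e.
Proof.
move=> e0; have e20 : 0 < e / 2 by rewrite divr_gt0.
have /cvg_nrP/(_ _ e20) [/= d d0 hd] := @hW x.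
(* Half of [d] is spent on [rho] and half on [radius k], which keeps their product above $1 - d$. *)
pose d1 := Num.min 1 (d / 2).
have d10 : 0 < d1 by rewrite lt_min ltr01 divr_gt0.
have d1d : d1 <= d / 2 by rewrite ge_min lexx orbT.
have d11 : d1 <= 1 by rewrite ge_min lexx.
exists d1; first by rewrite d10.
move=> rho /andP[rhod rho1]; have rho0 : 0 <= rho by lra.
have x1 : 0 < nr x + 1 by rewrite ltr_wpDl ?nr_ge0.
have m0 : 0 < Num.min (d / 2) (e / 2 / (nr x + 1)) by rewrite lt_min !divr_gt0.
have /cvgrPdist_lt/(_ _ m0) : harmonic @ \oo --> (0 : R) := cvg_harmonic.
apply: filterS => k; rewrite sub0r normrN ger0_norm//= lt_min => /andP[kd kx].
have /andP[k0 k1] : 0 <= (radius k : R) < 1 := radius_itv k.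
set s := radius k * rho.
have s1 : s < 1 by apply: le_lt_trans k1; rewrite -[leRHS]mulr1 ler_wpM2l.
have sd : 1 - d < s.
  rewrite /s /radius mulrBl mul1r.
  have : k.+1%:R^-1 * rho <= k.+1%:R^-1 by rewrite -[leRHS]mulr1 ler_wpM2l.
  by move: kd; move: (k.+1%:R^-1 * rho) (k.+1%:R^-1) => z1 z2; lra.
have hs : ball (1 : R) d s by rewrite /ball /= gtr0_norm ?subr_gt0//; lra.
rewrite (splitr e) -[W x - _](subrKA (limn (series (fun n =>
  ((a n : R[i]) * s%:C ^+ n) *: iter n T x)))).
apply: le_lt_trans (ler_nrD _ _) _; apply: ltr_leD; first exact: hd.
have -> : pv (rcoef a k) (N k) (scaled rho) x =
    series (fun n => ((a n : R[i]) * s%:C ^+ n) *: iter n T x) (N k).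
  rewrite /pv /series/= big_mkord; apply: eq_bigr => j _.
  by rewrite iter_scaled scalerA /rcoef /s rmorphM/= exprMn mulrA rmorphXn.
have rho01 : 0 <= rho <= 1 by rewrite rho0.
apply: tail_le; first exact: cvg_term.
move=> N'; apply: le_trans (_ : \sum_(N k <= j < N') nr (a j) * radius k ^+ j * nr x <= _).
  by apply: ler_sum => j _; exact: nr_term.
rewrite -mulr_suml; apply: le_trans (_ : k.+1%:R^-1 * (nr x + 1) <= _).
  apply: ler_pM; rewrite ?nr_ge0//; last by rewrite lerDl.
  by apply: sumr_ge0 => j _; rewrite mulr_ge0 ?nr_ge0 ?exprn_ge0.
by rewrite -ler_pdivlMr// ltW.
Qed.

Lemma scaled1 : scaled 1 = T.
Proof. by apply/funext => x; rewrite /scaled scale1r. Qed.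

Lemma approx_W1 x : (fun k => pv (rcoef a k) (N k) T x) @ \oo --> W x.
Proof.
apply/cvg_nrP => e e0; have [d /andP[d0 d1] /(_ 1)] := approx_W x e0.
by rewrite scaled1; apply; rewrite lexx andbT; lra.
Qed.

Lemma W_comm x : W (T x) = T (W x).
Proof.
apply/subr0_eq/nr_eq0/eqP; rewrite eq_le nr_ge0 andbT; apply/ler_addgt0Pl => e e0.
have e20 : 0 < e / 2 by rewrite divr_gt0.
have /cvg_nrP/(_ _ e20) h1 := @approx_W1 x.
have /cvg_nrP/(_ _ e20) h2 := @approx_W1 (T x).
have [k [h3 h4]] := filter_ex (filterI h1 h2).
have := pv_op (rcoef a k) (N k) 1 x; rewrite scaled1 => pvT.
move: h4; rewrite pvT => h4.
rewrite addr0 -[_ - _](subrKA (T (pv (rcoef a k) (N k) T x))).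
apply: le_trans (ler_nrD _ _) _; rewrite (splitr e) lerD ?(ltW h4)//.
by rewrite nrB -(@opB T)//; apply: le_trans (cT _) _; exact: ltW.
Qed.

Lemma pv_shift c n i S x : clinear S -> (i < n)%N ->
  pv (fun j => c (i + j)%N) (n - i) S x =
  c i *: x + pv (fun j => c (i.+1 + j)%N) (n - i.+1) S (S x).
Proof.
move=> lS lin; rewrite /pv -subSS subSn// big_ord_recl/= addn0; congr (_ + _).
by apply: eq_bigr => j _; rewrite -iterSr addSnnS.
Qed.

(** With $S = \rho T$ the von Neumann bound is applied to $y$ at index $i$ and to $Sy$ at index
    $i+1$; by [pv_shift] the two remainder vectors differ by $c_i y$. The witnesses are $p(S) y$ and
    $p(S) T y$, and the factor $\rho^2$ comes from $p(S) S y = \rho\, p(S) T y$. *)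
Lemma W_defect_approx i y (e : R) : (0 < i)%N -> 0 < e ->
  exists rho v v', [/\ 0 <= rho <= 1, 1 - e < rho,
    nr (W y - v) < e /\ nr (W (T y) - v') < e,
    nr v ^+ 2 <= nr y ^+ 2 + e &
    nr (a i) ^+ 2 / 4 * (nr y ^+ 2 - nr (T y) ^+ 2) <=
    2 * (nr y ^+ 2 - nr v ^+ 2 + e) +
    2 * (nr (T y) ^+ 2 - rho ^+ 2 * nr v' ^+ 2 + e)].
Proof.
move=> i0 e0.
have [d1 /andP[d10 d11] ap1] := approx_W y e0.
have [d2 /andP[d20 d21] ap2] := approx_W (T y) e0.
pose d := Num.min (Num.min d1 d2) (Num.min e 1).
have dd1 : d <= d1 by rewrite /d !ge_min lexx.
have dd2 : d <= d2 by rewrite /d !ge_min lexx orbT.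
have de : d <= e by rewrite /d !ge_min lexx !orbT.
have d1' : d <= 1 by rewrite /d !ge_min lexx !orbT.
have d0 : 0 < d by rewrite /d !lt_min d10 d20 e0 ltr01.
pose rho := 1 - d / 2.
have rho0 : 0 <= rho by rewrite /rho; lra.
have rho1 : rho < 1 by rewrite /rho; lra.
pose B := (nr y / (1 - rho)) ^+ 2.
have B0 : 0 <= B by rewrite sqr_ge0.
have pi0 := pi_gt0 R.
(* This makes $B \cdot 2\pi/r$ at most $\pi e$; then [k] is chosen so that $B r$ times the defect is
   also at most $\pi e$. The summand 1 keeps [r] positive when [B] vanishes. *)
pose r := 2 * B / e + 1.
have r0 : 0 < r by rewrite /r ltr_wpDl// divr_ge0 ?(ltW e0)// mulr_ge0.
have Br : B * (2 * pi / r) <= pi * e.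
  rewrite mulrA ler_pdivrMr// /r.
  have -> : pi * e * (2 * B / e + 1) = B * (2 * pi) + pi * e by field; rewrite gt_eqF.
  by rewrite lerDl mulr_ge0// ltW.
have Br0 : 0 < B * r + 1 by rewrite ltr_wpDl// mulr_ge0// ltW.
have dk0 : 0 < pi * e / (B * r + 1) by rewrite divr_gt0// mulr_gt0.
have /cvgrPdist_lt/(_ _ dk0) hdef := Ndefect.
have rad : \forall k \near \oo, 1 / 2 < (radius k : R) ^+ i.
  have cX m : (fun k => (radius k : R) ^+ m) @ \oo --> (1 : R).
    elim: m => [|m IH]; first exact: cvg_cst.
    have cm := cvgM (@cvg_radius R) IH; rewrite mulr1 in cm.
    by under eq_fun do rewrite exprS; exact: cm.
  by have /cvgr_gt := @cX i; apply; lra.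
have rhod1 : 1 - d1 < rho <= 1 by rewrite /rho; apply/andP; split; lra.
have rhod2 : 1 - d2 < rho <= 1 by rewrite /rho; apply/andP; split; lra.
have [k [[[h1 h2] [h3 h4]] ik]] := filter_ex (filterI (filterI
  (filterI (ap1 _ rhod1) (ap2 _ rhod2)) (filterI hdef rad)) (nbhs_infty_gt i)).
pose c := rcoef a k; pose S := scaled rho.
exists rho, (pv c (N k) S y), (pv c (N k) S (T y)).
have lS : clinear S by exact: clinear_scaled.
have Srho x : nr (S x) <= rho * nr x.
  by rewrite /S /scaled nrZ -[Re _]/(nr (_ : R[i]^o)) nr_real// ler_wpM2l.
have iN : (i < N k)%N by exact: leq_trans ik (kN k).
have rho01 : 0 <= rho < 1 by rewrite rho0.
have err x : nr x <= nr y ->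
    (nr x / (1 - rho)) ^+ 2 * (r * defect c (N k) + 2 * pi / r) <= 2 * pi * e.
  move=> xy; apply: le_trans (_ : B * (r * defect c (N k) + 2 * pi / r) <= _).
    rewrite ler_wpM2r//; last first.
      rewrite lerXn2r ?nnegrE ?divr_ge0 ?nr_ge0 ?subr_ge0 ?(ltW rho1)//.
      by rewrite ler_wpM2r// invr_ge0 subr_ge0 ltW.
    rewrite addr_ge0 ?divr_ge0 ?mulr_ge0 ?(ltW r0) ?(ltW pi0)//.
    by apply: Rintegral_ge0 => t _; exact: sqr_ge0.
  rewrite mulrDr; have -> : 2 * pi * e = pi * e + pi * e by ring.
  apply: lerD => //; rewrite mulrA.
  have dc : defect c (N k) <= pi * e / (B * r + 1).
    by apply/ltW/(le_lt_trans _ h3); rewrite sub0r normrN ler_norm.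
  apply: le_trans (_ : B * r * (pi * e / (B * r + 1)) <= _).
    by rewrite ler_wpM2l// mulr_ge0// ltW.
  rewrite mulrA ler_pdivrMr// mulrC ler_wpM2l ?lerDl//.
  by rewrite mulr_ge0// ltW.
pose dl x := nr x ^+ 2 - nr (S x) ^+ 2.
have vN x j : nr x <= nr y -> (0 < j <= N k)%N ->
    nr (pv c (N k) S x) ^+ 2 + dl (pv (fun m => c (j + m)%N) (N k - j) S x) <=
    nr x ^+ 2 + e.
  move=> xy jN; have := von_neumann_bound lS rho01 Srho c x r0 jN.
  move=> /le_trans/(_ (lerD (lexx _) (err _ xy))).
  by rewrite -mulrDr ler_pM2l// mulr_gt0.
have dlpos x : 0 <= dl x.
  rewrite /dl subr_ge0 lerXn2r ?nnegrE ?nr_ge0//; apply: le_trans (Srho x) _.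
  by rewrite -[leRHS]mul1r ler_wpM2r ?nr_ge0// ltW.
have Sy : nr (S y) <= nr y.
  by apply: le_trans (Srho y) _; rewrite -[leRHS]mul1r ler_wpM2r ?nr_ge0// ltW.
have i1 : (0 < i <= N k)%N by rewrite i0 ltnW.
have i2 : (0 < i.+1 <= N k)%N by [].
have := vN y i (lexx _) i1.
have := vN (S y) i.+1 Sy i2.
have := pv_shift c y lS iN.
set z1 := pv (fun m => c (i + m)%N) _ _ _.
set z2 := pv (fun m => c (i.+1 + m)%N) _ _ _ => z12 b2 b1.
(* The parallelogram law for [dl]. The constant $1/4$ is a lower bound for $r_k^{2i}$, since $r_k^i
   > 1/2$. *)
have par : nr (a i) ^+ 2 / 4 * (nr y ^+ 2 - nr (T y) ^+ 2) <= 2 * dl z1 + 2 * dl z2.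
  have -> : 2 * dl z1 + 2 * dl z2 = dl (z1 + z2) + dl (z1 - z2).
    rewrite /dl (@opD S)// (@opB S)// -!ripxx !(ripDl, ripNl) !(ripDr, ripNr).
    by ring.
  rewrite {2}z12 addrK.
  apply: ler_wpDl => //; rewrite /dl (@opZ S)// !(nrZ_sq (c i)) -mulrBr.
  apply: ler_pM; rewrite ?divr_ge0 ?sqr_ge0 ?subr_ge0//.
  - by rewrite lerXn2r ?nnegrE ?nr_ge0.
  - rewrite csq_nr /c /rcoef nrM -rmorphXn nr_real; last by rewrite ltW// (lt_trans _ h4).
    rewrite exprMn ler_wpM2l ?sqr_ge0//.
    by move: h4; move: (_ ^+ i) => z h4; nra.
  - rewrite lerD2l lerN2 lerXn2r ?nnegrE ?nr_ge0//.
    apply: le_trans (_ : rho * nr (T y) <= _).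
      by rewrite /S /scaled nrZ -[Re _]/(nr (_ : R[i]^o)) nr_real.
    by rewrite -[leRHS]mul1r ler_wpM2r ?nr_ge0// ltW.
have pS : nr (pv c (N k) S (S y)) ^+ 2 = rho ^+ 2 * nr (pv c (N k) S (T y)) ^+ 2.
  have -> : pv c (N k) S (S y) = rho%:C *: pv c (N k) S (T y).
    rewrite /pv scaler_sumr; apply: eq_bigr => j _.
    by rewrite {2}/S /scaled (@opZ (iter j S)); [rewrite !scalerA mulrC|exact: clinear_iter].
  by rewrite nrZ -[Re _]/(nr (_ : R[i]^o)) nr_real// exprMn.
have SyT : nr (S y) ^+ 2 <= nr (T y) ^+ 2.
  rewrite lerXn2r ?nnegrE ?nr_ge0// /S /scaled nrZ -[Re _]/(nr (_ : R[i]^o)) nr_real//.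
  by rewrite -[leRHS]mul1r ler_wpM2r ?nr_ge0// ltW.
split => //.
- by rewrite rho0 ltW.
- by rewrite /rho; lra.
- by have := dlpos z1; lra.
- by rewrite pS in b2; lra.
Qed.


(** Let the error in [W_defect_approx] tend to 0 along $1/(m+1)$, which forces $\rho \to 1$. *)
Lemma W_defect i y : (0 < i)%N -> nr (W y) <= nr y /\
  nr (a i) ^+ 2 / 4 * (nr y ^+ 2 - nr (T y) ^+ 2) <=
    2 * (nr y ^+ 2 - nr (W y) ^+ 2) + 2 * (nr (T y) ^+ 2 - nr (W (T y)) ^+ 2).
Proof.
move=> i0; pose e m : R := m.+1%:R^-1.
have em m : 0 < e m by rewrite invr_gt0.
have ce : e @ \oo --> (0 : R) := cvg_harmonic.
have /choice[f hf] : forall m, exists f : R * H * H,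
    [/\ 0 <= f.1.1 <= 1, 1 - e m < f.1.1,
    nr (W y - f.1.2) < e m /\ nr (W (T y) - f.2) < e m,
    nr f.1.2 ^+ 2 <= nr y ^+ 2 + e m &
    nr (a i) ^+ 2 / 4 * (nr y ^+ 2 - nr (T y) ^+ 2) <=
    2 * (nr y ^+ 2 - nr f.1.2 ^+ 2 + e m) +
    2 * (nr (T y) ^+ 2 - f.1.1 ^+ 2 * nr f.2 ^+ 2 + e m)].
  move=> m; have [rho [v [v' h]]] := W_defect_approx y i0 (em m).
  by exists (rho, v, v').
have cnr2 (g : nat -> H) x : (forall m, nr (x - g m) < e m) ->
    (fun m => nr (g m) ^+ 2) @ \oo --> nr x ^+ 2.
  move=> h; have : g @ \oo --> x.
    apply/cvg_nrP => d d0; have /cvgrPdist_lt/(_ _ d0) := ce.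
    apply: filterS => m; rewrite sub0r normrN ger0_norm ?ltW//; exact: lt_trans.
  by move=> /cvg_nr h'; under eq_fun do rewrite expr2; rewrite expr2; exact: cvgM.
have cv : (fun m => nr (f m).1.2 ^+ 2) @ \oo --> nr (W y) ^+ 2.
  by apply: cnr2 => m; have [_ _ []] := hf m.
have cv' : (fun m => nr (f m).2 ^+ 2) @ \oo --> nr (W (T y)) ^+ 2.
  by apply: cnr2 => m; have [_ _ []] := hf m.
have crho : (fun m => (f m).1.1) @ \oo --> (1 : R).
  apply/cvgrPdist_lt => d d0; have /cvgrPdist_lt/(_ _ d0) := ce.
  apply: filterS => m; rewrite sub0r normrN ger0_norm ?ltW// => h.
  have [/andP[_ l1] l2 _ _ _] := hf m; rewrite ger0_norm ?subr_ge0//.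
  by move: h l1 l2; move: (e m) ((f m).1.1) => p q; lra.
split.
  rewrite -(@ler_pXn2r _ 2) ?nnegrE ?nr_ge0//.
  rewrite -[leRHS]addr0.
  apply: (ler_cvg_to cv (cvgD (cvg_cst _) ce)); apply: nearW => m.
  by have [] := hf m.
have c1 : (fun m => 2 * (nr y ^+ 2 - nr (f m).1.2 ^+ 2 + e m)) @ \oo -->
    2 * (nr y ^+ 2 - nr (W y) ^+ 2 + 0).
  by apply: cvgM; [exact: cvg_cst|apply: cvgD => //; apply: cvgB => //; exact: cvg_cst].
have c2 : (fun m =>
    2 * (nr (T y) ^+ 2 - (f m).1.1 * (f m).1.1 * nr (f m).2 ^+ 2 + e m)) @ \oo -->
    2 * (nr (T y) ^+ 2 - 1 * 1 * nr (W (T y)) ^+ 2 + 0).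
  apply: cvgM; first exact: cvg_cst.
  apply: cvgD => //; apply: cvgB; first exact: cvg_cst.
  by apply: cvgM => //; exact: cvgM.
have := ler_cvg_to (cvg_cst (nr (a i) ^+ 2 / 4 * (nr y ^+ 2 - nr (T y) ^+ 2))) (cvgD c1 c2).
rewrite !addr0 !mul1r; apply; apply: nearW => m.
by have [_ _ _ _] := hf m; rewrite [X in X * nr _ ^+ 2]expr2.
Qed.

Lemma W_contractive : contractive W.
Proof. by move=> x; have [] := @W_defect 1 x. Qed.

Lemma iterW_comm n x : iter n W (T x) = T (iter n W x).
Proof. by elim: n => //= n ->; rewrite W_comm. Qed.

(** * The inequality $q_W \le q_T$ *)

Section Comparison.
Context (AT AW : H -> H).
Hypotheses (hAT : is_A_T ip T AT) (hAW : is_A_T ip W AW).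

(** In [W_defect] at $y = W^n x$ the right side consists of differences of consecutive terms of
    convergent sequences, so it tends to 0; the nonzero coefficient allows division on the left. *)
Lemma AW_inv i x : (0 < i)%N -> a i != 0 -> rip (AW (T x)) (T x) = rip (AW x) x.
Proof.
move=> i0 ai.
have k0 : 0 < nr (a i) ^+ 2 / 4.
  rewrite divr_gt0// exprn_gt0// lt0r nr_ge0 andbT.
  by apply: contra ai => /eqP/nr_eq0 ->.
have s1 := @A_cvg_sq _ _ hAW x.
have s2 := @A_cvg_sq _ _ hAW (T x).
have s1' : (fun n => nr (iter n.+1 W x) ^+ 2) @ \oo --> rip (AW x) x.
  by have := s1; rewrite -cvg_shiftS.
have s2' : (fun n => nr (iter n.+1 W (T x)) ^+ 2) @ \oo --> rip (AW (T x)) (T x).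
  by have := s2; rewrite -cvg_shiftS.
apply/eqP; rewrite eq_le; apply/andP; split.
  apply: (ler_cvg_to s2 s1); apply: nearW => n; rewrite iterW_comm.
  by rewrite lerXn2r ?nnegrE ?nr_ge0.
rewrite -subr_le0 -(pmulr_rle0 _ k0).
have cl : (fun n => nr (a i) ^+ 2 / 4 * (nr (iter n W x) ^+ 2 - nr (iter n W (T x)) ^+ 2))
    @ \oo --> nr (a i) ^+ 2 / 4 * (rip (AW x) x - rip (AW (T x)) (T x)).
  by apply: cvgM; [exact: cvg_cst|exact: cvgB].
have cr : (fun n => 2 * (nr (iter n W x) ^+ 2 - nr (iter n.+1 W x) ^+ 2) +
      2 * (nr (iter n W (T x)) ^+ 2 - nr (iter n.+1 W (T x)) ^+ 2)) @ \oo -->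
    2 * (rip (AW x) x - rip (AW x) x) +
    2 * (rip (AW (T x)) (T x) - rip (AW (T x)) (T x)).
  by apply: cvgD; apply: cvgM; try exact: cvg_cst; exact: cvgB.
have := ler_cvg_to cl cr; rewrite !subrr !mulr0 addr0; apply; apply: nearW => n /=.
by have [_] := W_defect (iter n W x) i0; rewrite -!iterW_comm.
Qed.

Lemma AW_le_AT i x : (0 < i)%N -> a i != 0 -> rip (AW x) x <= rip (AT x) x.
Proof.
move=> i0 ai; apply: (ler_cvg_to (cvg_cst _) (@A_cvg_sq _ _ hAT x)).
apply: nearW => n; rewrite -[leLHS](_ : rip (AW (iter n T x)) (iter n T x) = _).
  by apply: (A_le_sq hAW); exact: W_contractive.
by elim: n => //= n IH; rewrite (AW_inv _ i0).
Qed.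

End Comparison.

(** * The inequality $q_T \le q_W$ *)

Section Isometry.
Context (Ts Ws A : H -> H).
Hypotheses (adT : is_adjoint ip T Ts) (adW : is_adjoint ip W Ws).
Hypothesis (hA : is_A_T ip T A).

Let cTs : contractive Ts. Proof. exact: adjoint_contractive adT cT. Qed.
Let lA : clinear A. Proof. exact: A_clinear lT hA. Qed.
Let cA : contractive A. Proof. exact: A_contractive cT hA. Qed.
Let lW : clinear W. Proof. exact: adjoint_clinear_left adW. Qed.

Lemma W_iter_comm q x : W (iter q T x) = iter q T (W x).
Proof. by elim: q => //= q <-; rewrite W_comm. Qed.

Lemma A_W_le q y w : rip (W (iter q T (y - T (Ts y)))) (A (W w)) -
  rip (iter q T (y - T (Ts y))) (A w) <= 0.
Proof.
set z := y - T (Ts y); rewrite W_iter_comm; set dlt := _ - _.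
have bound (r : R) : 0 < r -> 4 * pi * r * dlt <= 2 * pi * nr w ^+ 2.
  move=> r0; pose c k := rcoef a k.
  have cl : (fun k => 4 * pi * r *
      (rip (iter q T (pv (c k) (N k) T z)) (A (pv (c k) (N k) T w)) -
      rip (iter q T z) (A w))) @ \oo --> 4 * pi * r * dlt.
    apply: cvgM; first exact: cvg_cst.
    apply: cvgB; last exact: cvg_cst.
    apply: cvg_rip2.
      apply: cvg_contractive;
        [exact: clinear_iter|exact: contractive_iter|exact: approx_W1].
    by apply: cvg_contractive => //; exact: approx_W1.
  have cr : (fun k =>
      r ^+ 2 * nr y ^+ 2 * defect (c k) (N k) + 2 * pi * nr w ^+ 2) @ \oo -->
      r ^+ 2 * nr y ^+ 2 * 0 + 2 * pi * nr w ^+ 2.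
    apply: cvgD; last exact: cvg_cst.
    by apply: cvgM => //; exact: cvg_cst.
  have := ler_cvg_to cl cr; rewrite mulr0 add0r; apply; apply: nearW => k.
  exact: (toeplitz_bound lT lA adT cTs cT cA (A_TsAT adT hA)).
rewrite leNgt; apply/negP => dlt0.
(* For this [r] the bound would read $4\pi(|w|^2 + 1) \le 2\pi |w|^2$. *)
have r0 : 0 < (nr w ^+ 2 + 1) / dlt by rewrite divr_gt0// ltr_wpDl ?sqr_ge0.
have := bound _ r0; rewrite -mulrA divfK ?gt_eqF//.
have pi0 := pi_gt0 R; have := sqr_ge0 (nr w); move: (nr w ^+ 2) (pi : R) pi0 => s p p0 s0.
by rewrite leNgt => /negP; apply; nra.
Qed.

(** The left side of [A_W_le] is odd in [y], so applying it to [y] and [- y] gives equality. *)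
Lemma A_W_kill q y w : let x := iter q T (y - T (Ts y)) in
  rip (A (W x)) (W w) = rip (A x) w.
Proof.
move=> x; rewrite (A_sym hA) [RHS](A_sym hA) ripC [RHS]ripC.
apply/eqP; rewrite -subr_eq0 eq_le A_W_le /=.
have lTs := adjoint_clinear adT.
have := A_W_le q (- y) w; rewrite (@opN Ts)// (@opN T)// -opprD.
rewrite (@opN (iter q T)); last exact: clinear_iter.
by rewrite (@opN W)// !ripNl opprK -oppr_ge0 opprD opprK.
Qed.

(** The operator $B = A - W'AW$ meets the hypotheses of [cnu_invariant_eq0]; its invariance under
    [T] uses that [W] commutes with [T]. *)
Lemma A_W_inv x y : op_cnu ip T -> rip (A (W x)) (W y) = rip (A x) y.
Proof.
move=> cnu; pose B x := A x - Ws (A (W x)).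
have BE v w : rip (B v) w = rip (A v) w - rip (A (W v)) (W w).
  by rewrite /B ripBl; congr (_ - _); rewrite ripC -(adjoint_rip _ _ adW) ripC.
have B0 : B x = 0.
  apply: (@cnu_invariant_eq0 T Ts B) => //.
  - by move=> v w; rewrite !BE (A_sym hA) (A_sym hA (W v)).
  - by move=> v w; rewrite !BE !W_comm !(A_inv hA).
  - by move=> q v w; rewrite BE A_W_kill subrr.
by apply/esym/eqP; rewrite -subr_eq0 -BE B0 /rip ip0l.
Qed.

Lemma AT_le_AW AW x : is_A_T ip W AW -> op_cnu ip T ->
  rip (A x) x <= rip (AW x) x.
Proof.
move=> hAW cnu; apply: (ler_cvg_to (cvg_cst _) (@A_cvg_sq _ _ hAW x)).
apply: nearW => n; rewrite -[leLHS](_ : rip (A (iter n W x)) (iter n W x) = _).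
  exact: (A_le_sq hA).
by elim: n => //= n IH; rewrite A_W_inv.
Qed.

End Isometry.

End FunctionalCalculus.

(** * A nonzero higher coefficient and the conclusion *)

Lemma nonconstant_coef (u : R[i]^o -> R[i]^o) (a : nat -> R[i]^o) :
  (forall z : R[i]^o, `|z| < 1 -> series (fun n => a n * z ^+ n) @ \oo --> u z) ->
  nonconstant_on_disc u -> exists2 i, (0 < i)%N & a i != 0.
Proof.
move=> au ncu; apply: contrapT => h; apply: ncu; exists (a 0%N) => z z1.
have a0 i : (0 < i)%N -> a i = 0.
  by move=> i0; apply: contrapT => /eqP ai; apply: h; exists i.
have c0 : series (fun n => a n * z ^+ n) @ \oo --> a 0%N.
  rewrite -cvg_shiftS (_ : (fun n => _) = fun=> a 0%N); first exact: cvg_cst.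
  apply/funext => n; rewrite /series /= big_nat_recl// expr0 mulr1 big1 ?addr0// => j _.
  by rewrite a0// mul0r.
apply: (@cvg_unique R[i]^o _ _ _ _ _ (au z z1) c0); exact: norm_hausdorff.
Qed.

Lemma A_funcalc T u uT AT AuT : op_contraction T -> op_cnu ip T ->
  inner_function u -> nonconstant_on_disc u -> is_funcalc T u uT ->
  is_A_T ip T AT -> is_A_T ip uT AuT -> AT = AuT.
Proof.
move=> hT cnu inu ncu [a [au hW]] hAT hAuT.
have [i i0 ai] := nonconstant_coef au ncu.
have [N [kN Ntail Ndef]] := inner_approx au inu.
have lT := op_contraction_clinear hT; have cT := op_contraction_nr hT.
have [Ts [adT _]] := hAT; have [Ws [adW _]] := hAuT.
apply: (A_eq hAT hAuT) => x; apply/eqP; rewrite eq_le; apply/andP; split.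
  exact: (AT_le_AW lT cT au hW Ntail Ndef adT adW).
exact: (AW_le_AT lT cT au hW kN Ntail Ndef hAT hAuT x i0 ai).
Qed.

End InnerProduct.

Theorem mainTheorem5 (R : realType) (H : completeNormedModType R[i])
    (ip : H -> H -> R[i]) (hip : is_inner_product ip)
    (T T1 T2 : H -> H) (hT : op_contraction T)
    (hT1 : op_contraction T1) (hT2 : op_contraction T2) :
  (* (i) *)
  (T1 \o T2 = T2 \o T1 ->
   forall A12 A1 A2 : H -> H,
     is_A_T ip (T1 \o T2) A12 -> is_A_T ip T1 A1 -> is_A_T ip T2 A2 ->
     op_le ip A12 A1 /\ op_le ip A12 A2) /\
  (* (ii) *)
  (op_cnu ip T -> forall u : R[i]^o -> R[i]^o, inner_function u -> nonconstant_on_disc u ->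
   forall uT : H -> H, is_funcalc T u uT ->
   forall AT AuT : H -> H, is_A_T ip T AT -> is_A_T ip uT AuT -> AT = AuT) /\
  (* (iii) *)
  (forall A A12 : H -> H,
     is_A_T ip T1 A -> is_A_T ip T2 A -> is_A_T ip (T1 \o T2) A12 ->
     op_le ip A A12) /\
  (* (iv) *)
  (T1 \o T2 = T2 \o T1 ->
   forall A A12 : H -> H,
     is_A_T ip T1 A -> is_A_T ip T2 A -> is_A_T ip (T1 \o T2) A12 ->
     A12 = A).
Proof.
have l1 := op_contraction_clinear hT1; have l2 := op_contraction_clinear hT2.
have c1 := op_contraction_nr hT1; have c2 := op_contraction_nr hT2.
have l12 := clinear_comp l1 l2.
split=> [comm A12 A1 A2 h12 h1 h2|].
  split.
    apply: (op_leP hip h12 h1) => //.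
    by rewrite comm in h12; exact: (A_comp_le hip (esym comm) c2 h12 h1).
  by apply: (op_leP hip h12 h2) => //; exact: (A_comp_le hip comm c1 h12 h2).
split=> [cnu u inu ncu uT fc AT AuT|]; first exact: (A_funcalc hip hT cnu inu ncu fc).
split=> [A A12 h1 h2 h12|comm A A12 h1 h2 h12].
  by apply: (op_leP hip h1 h12) => //; exact: (A_comp_ge hip c1 c2 h1 h2 h12).
apply: (A_eq hip h12 h1) => x; apply/eqP; rewrite eq_le.
by rewrite (A_comp_le hip comm c1 h12 h2) (A_comp_ge hip c1 c2 h1 h2 h12).
Qed.
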